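(* Let $T>0$, $\tau\in[0,T)$, and let $\zeta$ be the solution of the adjoint equation $$\zeta_t-\operatorname{div}\left(D_pH(x,Du)\,\zeta\right)=\Delta\zeta\ \text{ in }\mathbb{R}^d\times(\tau,T],\qquad \zeta(x,\tau)=\phi(x),$$ where $\phi\ge 0$ has compact support, $\phi\in L^1(\mathbb{R}^d)\cap L^{p'}(\mathbb{R}^d)$ and $\|\phi\|_{L^{p'}(\mathbb{R}^d)}=1$ ($1<p'<\infty$), and $(u,m)$ is a solution of the mean-field game system $$-u_t+H(x,Du)=\Delta u+g(m),\qquad m_t-\operatorname{div}(D_pH(x,Du)\,m)=\Delta m$$ in $\mathbb{R}^d\times[0,T]$ with $u(x,T)=u_T(x)$, $m(x,0)=m_0(x)$. Then there exists $C>0$ such that for every $r\in(\tau,T]$, $$\int_{\mathbb{R}^d}\zeta(x,r)\ln[\zeta(x,r)]\,dx\ \ge\ -C-C\int_\tau^r\int_{\mathbb{R}^d}|D_pH(x,Du)|^2\zeta\,dx\,dt .$$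
   Context: $H:\mathbb{R}^d\times\mathbb{R}^d\to\mathbb{R}$ is a smooth Hamiltonian, strictly convex in its second variable, non-negative and coercive; $Du$ is the spatial gradient of $u$. Solutions are understood in the a-priori sense: $u,m,\zeta$ are smooth (for $\zeta$, for times $t>\tau$), $m,\zeta\ge 0$, regular and decaying enough at infinity that the usual integrations by parts are justified (in particular $\int_{\mathbb{R}^d}\zeta(x,t)\,dx=\int_{\mathbb{R}^d}\phi\,dx$ for all $t$). By convention $0\ln 0=0$. The constant $C$ may depend on $d,T,p'$, the support of $\phi$ and the data, but not on $(u,m)$, $\zeta$, $\tau$ or $r$. *)

(* Defs.v *)
From HB Require Import structures.
From mathcomp Require Import all_boot all_order all_algebra.
From mathcomp Require Import all_classical all_reals all_analysis.

Set Implicit Arguments.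
Unset Strict Implicit.
Unset Printing Implicit Defensive.

Import Order.TTheory GRing.Theory Num.Theory.
Import numFieldNormedType.Exports.

Local Open Scope classical_set_scope.
Local Open Scope ring_scope.

(* R^d is 'rV[R]_d.  Beware that the library's norm `|x| on 'rV[R]_d is the sup
   norm; the Euclidean norm is enorm below. *)

Section measurable_rV.
Context {R : realType} (d : nat).

Let coord (i : 'I_d) (x : 'rV[R]_d) : R := x ord0 i.

Let rV_set0 : g_sigma_preimage coord set0.
Proof. exact: sigma_algebra0. Qed.

Let rV_setC A : g_sigma_preimage coord A -> g_sigma_preimage coord (~` A).
Proof. exact: sigma_algebraC. Qed.

Let rV_bigcup (F : (set _)^nat) : (forall i, g_sigma_preimage coord (F i)) ->
  g_sigma_preimage coord (\bigcup_i (F i)).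
Proof. exact: sigma_algebra_bigcup. Qed.

(* The sigma-algebra generated by the coordinates, i.e., the Borel sets. *)
HB.instance Definition _ := @isMeasurable.Build
  (measure_tuple_display default_measure_display)
  'rV[R]_d (g_sigma_preimage coord) rV_set0 rV_setC rV_bigcup.

Lemma measurable_coord (i : 'I_d) :
  measurable_fun [set: 'rV[R]_d] (fun x : 'rV[R]_d => x ord0 i).
Proof.
move=> _ Y mY; rewrite setTI; apply: sub_sigma_algebra => /=.
rewrite -bigcup_seq/=; exists i => /=; first by rewrite mem_index_enum.
by exists Y => //; rewrite setTI.
Qed.

Lemma measurable_fun_rV d1 (T : measurableType d1) (f : T -> 'rV[R]_d) :
  (forall i, measurable_fun [set: T] (fun x => f x ord0 i)) ->
  measurable_fun [set: T] f.
Proof.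
move=> mf.
have H : g_sigma_preimage (fun i => coord i \o f) `<=` measurable.
  apply: smallest_sub; first exact: sigma_algebra_measurable.
  rewrite -bigcup_seq; apply: bigcup_sub => i _ A [B mB <-].
  exact: mf.
rewrite g_sigma_preimage_comp in H.
by move=> _ A mA; apply: H; exists A.
Qed.

End measurable_rV.

Section lebesgue_rV.
Context {R : realType}.

Definition rV_cons d (z : measurableTypeR R * 'rV[R]_d) : 'rV[R]_d.+1 :=
  \row_i oapp (z.2 ord0) z.1 (unlift ord0 i).

Definition rV_uncons d (x : 'rV[R]_d.+1) : measurableTypeR R * 'rV[R]_d :=
  (x ord0 ord0, \row_i x ord0 (lift ord0 i)).

Lemma rV_consK d : cancel (@rV_cons d) (@rV_uncons d).
Proof.
move=> [a v]; rewrite /rV_uncons /rV_cons mxE unlift_none/=; congr pair.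
by apply/rowP => i; rewrite !mxE liftK.
Qed.

Lemma measurable_rV_cons d : measurable_fun [set: _] (@rV_cons d).
Proof.
apply: measurable_fun_rV => i.
under eq_fun do rewrite mxE.
case: unliftP => [j _|_] /=; last exact: measurable_fst.
exact: (measurableT_comp (measurable_coord j) measurable_snd).
Qed.

Lemma measurable_rV_uncons d : measurable_fun [set: _] (@rV_uncons d).
Proof.
apply/measurable_fun_pairP; split; first exact: (measurable_coord ord0).
apply: measurable_fun_rV => i.
rewrite /= (_ : (fun x => _) = fun x : 'rV[R]_d.+1 => x ord0 (lift ord0 i)).
  exact: measurable_coord.
by apply/funext => x /=; rewrite mxE.
Qed.

Section step.
Context (d : nat) (mu : {sigma_finite_measure set 'rV[R]_d -> \bar R}).

Definition lebesgue_step : set 'rV[R]_d.+1 -> \bar R :=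
  pushforward (lebesgue_measure \x mu)%E (@rV_cons d).

Let lebesgue_step0 : lebesgue_step set0 = 0%E.
Proof. by rewrite /lebesgue_step /pushforward preimage_set0 measure0. Qed.

Let lebesgue_step_ge0 A : (0 <= lebesgue_step A)%E.
Proof. exact: (measure_ge0 (lebesgue_measure \x mu)%E (_ @^-1` A)). Qed.

Let lebesgue_step_sigma_additive : semi_sigma_additive lebesgue_step.
Proof.
have mp A : measurable A -> measurable (@rV_cons d @^-1` A).
  by move=> mA; rewrite -[X in measurable X]setTI; exact: measurable_rV_cons.
move=> F mF tF mUF; rewrite /lebesgue_step /pushforward preimage_bigcup.
apply: measure_semi_sigma_additive.
- by move=> n; exact: mp.
- apply/trivIsetP => /= i j _ _ ij; rewrite -preimage_setI.
  by move/trivIsetP : tF => /(_ _ _ _ _ ij) ->//; rewrite preimage_set0.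
- by rewrite -preimage_bigcup; exact: mp.
Qed.

HB.instance Definition _ := isMeasure.Build _ _ _ lebesgue_step
  lebesgue_step0 lebesgue_step_ge0 lebesgue_step_sigma_additive.

Let lebesgue_step_sigma_finite : sigma_finite setT lebesgue_step.
Proof.
have /sigma_finiteP[F [FT ndF Foo]] := sigma_finiteT (@lebesgue_measure R).
have /sigma_finiteP[G [GT ndG Goo]] := sigma_finiteT mu.
exists (fun n => @rV_uncons d @^-1` (F n `*` G n)).
  rewrite -preimage_bigcup (_ : \bigcup_n _ = setT) ?preimage_setT//.
  rewrite -setXTT FT GT predeqE => -[x y]; split.
    by move=> [n _ []/= ? ?]; split; exists n.
  move=> [/= [n _ Fnx] [k _ Gky]]; exists (maxn n k) => //; split.
  - by move: x Fnx; exact/subsetPset/ndF/leq_maxl.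
  - by move: y Gky; exact/subsetPset/ndG/leq_maxr.
move=> n; have [mF Fn] := Foo n; have [mG Gn] := Goo n; split.
  rewrite -[X in measurable X]setTI.
  by apply: measurable_rV_uncons => //; exact: measurableX.
rewrite /lebesgue_step /pushforward -comp_preimage.
rewrite (_ : _ \o _ = id); last by apply/funext => z; exact: rV_consK.
by rewrite preimage_id product_measure1E// lte_mul_pinfty// ge0_fin_numE.
Qed.

HB.instance Definition _ := Measure_isSigmaFinite.Build _ _ _ lebesgue_step
  lebesgue_step_sigma_finite.

End step.

(* The d-dimensional Lebesgue measure, as the d-fold product of the Lebesgue
   measure on R. *)
Fixpoint lebesgue_rV d : {sigma_finite_measure set 'rV[R]_d -> \bar R} :=
  match d with
  | 0 => \d_(0 : 'rV[R]_0)
  | d'.+1 => lebesgue_step (lebesgue_rV d')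
  end.

End lebesgue_rV.

Section calculus.
Context {R : realType}.

Definition enorm d (v : 'rV[R]_d) : R := Num.sqrt (\sum_i v ord0 i ^+ 2).

Definition partial d (i : 'I_d) (f : 'rV[R]_d -> R) (x : 'rV[R]_d) : R :=
  'D_(delta_mx ord0 i) f x.

Definition grad d (f : 'rV[R]_d -> R) (x : 'rV[R]_d) : 'rV[R]_d :=
  \row_i partial i f x.

Definition divergence d (F : 'rV[R]_d -> 'rV[R]_d) (x : 'rV[R]_d) : R :=
  \sum_i partial i (fun y => F y ord0 i) x.

Definition laplacian d (f : 'rV[R]_d -> R) (x : 'rV[R]_d) : R :=
  \sum_i partial i (partial i f) x.

Fixpoint Ck (V : normedModType R) (k : nat) (f : V -> R) : Prop :=
  match k with
  | 0 => continuous f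
  | k'.+1 => (forall x, differentiable f x) /\ forall v, Ck k' ('D_v f)
  end.

Definition smooth (V : normedModType R) (f : V -> R) := forall k, Ck k f.

Definition tquot d (f : 'rV[R]_d -> R -> R) (x : 'rV[R]_d) (t : R) : R -> R :=
  fun s => (f x s - f x t) / (s - t).

(* The time derivative of f at (x, t) relative to the time interval I: it is
   one-sided at the endpoints of I. *)
Definition dt_in d (I : set R) (f : 'rV[R]_d -> R -> R) (x : 'rV[R]_d) (t : R)
    : R :=
  lim (tquot f x t s @[s --> within I t^']).

(* f is of class C^k on R^d x I; no condition is put on f at times outside I. *)
Fixpoint Ck_in d (k : nat) (I : set R) (f : 'rV[R]_d -> R -> R) : Prop :=
  match k with
  | 0 => {within [set z : 'rV[R]_d * R | I z.2], continuous
           (fun z => f z.1 z.2)}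
  | k'.+1 =>
    [/\ forall x t, I t -> differentiable (f ^~ t) x,
        forall i, Ck_in k' I (fun x t => partial i (f ^~ t) x),
        forall x t, I t -> cvg (tquot f x t s @[s --> within I t^']) &
        Ck_in k' I (dt_in I f)]
  end.

Definition smooth_in d (I : set R) (f : 'rV[R]_d -> R -> R) :=
  forall k, Ck_in k I f.

Definition strictly_convex d (f : 'rV[R]_d -> R) :=
  forall (p q : 'rV[R]_d) (l : R), p != q -> 0 < l < 1 ->
    f (l *: p + (1 - l) *: q) < l * f p + (1 - l) * f q.

Definition coercive d (f : 'rV[R]_d -> R) :=
  forall M : R, exists r : R, forall p, r <= enorm p -> M <= f p.

Definition has_support_in d (f : 'rV[R]_d -> R) (K : set 'rV[R]_d) :=
  closure [set x | f x != 0] `<=` K.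

End calculus.

Section mean_field_game.
Context {R : realType} (d : nat).
Implicit Types (H : 'rV[R]_d -> 'rV[R]_d -> R) (u m zeta : 'rV[R]_d -> R -> R).

Record hamiltonian H : Prop := {
  ham_smooth : smooth (fun z : 'rV[R]_d * 'rV[R]_d => H z.1 z.2) ;
  ham_convex : forall x, strictly_convex (H x) ;
  ham_ge0 : forall x p, 0 <= H x p ;
  ham_coercive : forall x, coercive (H x) }.

(* D_p H (x, Du (x, t)) *)
Definition DpH_Du H u (x : 'rV[R]_d) (t : R) : 'rV[R]_d :=
  grad (H x) (grad (u ^~ t) x).

Record mfg_solution H (g : R -> R) (T : R) (uT m0 : 'rV[R]_d -> R) u m
    : Prop := {
  mfg_smooth_u : smooth_in `[0, T] u ;
  mfg_smooth_m : smooth_in `[0, T] m ;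
  mfg_m_ge0 : forall x t, 0 <= t <= T -> 0 <= m x t ;
  mfg_hjb : forall x t, 0 <= t <= T ->
    - dt_in `[0, T] u x t + H x (grad (u ^~ t) x) =
    laplacian (u ^~ t) x + g (m x t) ;
  mfg_fp : forall x t, 0 <= t <= T ->
    dt_in `[0, T] m x t - divergence (fun y => m y t *: DpH_Du H u y t) x =
    laplacian (m ^~ t) x ;
  mfg_terminal : forall x, u x T = uT x ;
  mfg_initial : forall x, m x 0 = m0 x }.

(* As phi need not be continuous, zeta (., t) is also required to converge to
   phi as t tends to tau from the right, only in the weak sense, i.e., against
   continuous test functions with compact support.  The behaviour of zeta at
   infinity is only restricted by the conservation of the mass. *)
Record adjoint_solution H u (tau T : R) (phi : 'rV[R]_d -> R) zeta : Prop := {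
  adj_smooth : smooth_in `]tau, T] zeta ;
  adj_ge0 : forall x t, tau <= t <= T -> 0 <= zeta x t ;
  adj_eq : forall x t, tau < t <= T ->
    dt_in `]tau, T] zeta x t -
      divergence (fun y => zeta y t *: DpH_Du H u y t) x =
    laplacian (zeta ^~ t) x ;
  adj_initial : forall x, zeta x tau = phi x ;
  adj_initial_weak : forall psi : 'rV[R]_d -> R, continuous psi ->
    (exists2 K, compact K & has_support_in psi K) ->
    (\int[lebesgue_rV d]_x (psi x * zeta x t)%:E)%E @[t --> tau^'+] -->
    (\int[lebesgue_rV d]_x (psi x * phi x)%:E)%E ;
  adj_mass : forall t, tau <= t <= T ->
    (\int[lebesgue_rV d]_x (zeta x t)%:E = \int[lebesgue_rV d]_x (phi x)%:E)%E
  }.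

End mean_field_game.

(* Main.v *)
Require Import Defs.
From mathcomp Require Import all_boot all_order all_algebra.
From mathcomp Require Import all_classical all_reals all_analysis.
From mathcomp Require Import measurable_realfun ring lra.

(** Why the bound holds.  Minimising s ln s + s w over s >= 0 shows that
    s ln s >= - s w - exp (- w) for every w.  Integrated against a weight
    w(x) >= 0, this bounds the entropy of zeta (., r) from below, as soon as
    exp (- w) is integrable and the moment int w zeta (., r) is bounded from
    above.  The weight w(x) = sum_i ln (1 + x_i^2) grows fast enough for the
    former, because exp (- w) is the product of the functions 1 / (1 + x_i^2)
    ([integral_expRN_weight_lty]), and slowly enough for the latter: its first
    and second derivatives are bounded, so that the adjoint equation gives
      d/dt int w zeta = int (Lap w - D_pH . Dw) zeta
                     <= C int zeta + C int |D_pH|^2 zeta,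
    where |p| <= 1 + |p|^2.  The mass int zeta = int phi is bounded in terms of
    K only, because a <= 1 + a^p' for a >= 0 ([integral_le_Lnorm]).

    The behaviour of zeta at infinity is controlled only by the conservation of
    the mass, so that w itself cannot be used as a test function.  It is
    replaced by rho - cutoff rho, where cutoff rho = ((rho - w)_+)^3 / rho^2 is
    of class C^2 and has compact support.  This function lies between
    min (w, rho) and 3 w, and its derivatives are bounded uniformly in
    rho >= 1.  The constant rho is integrated by the conservation of the mass,
    and the compactly supported part by Green's formula in space
    ([integral_adjoint]) and the fundamental theorem of calculus in time
    ([integral_time_derivative]); this is [cutoff_evolution].  As zeta is smooth
    only after the time tau, the evolution is first followed over [s, r] with
    s > tau.  The initial datum enters when s tends to tau, by the weak
    convergence tested with the cutoff ([cutoff_moment_phi]); finally rho tends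
    to infinity by monotone convergence ([moment_le]). *)

Import Order.TTheory GRing.Theory Num.Theory.
Import numFieldNormedType.Exports.

Local Open Scope classical_set_scope.
Local Open Scope ring_scope.

Set Implicit Arguments.
Unset Strict Implicit.
Unset Printing Implicit Defensive.

(** * Continuous functions on R^d are Borel *)

Lemma continuous_pair (X Y Z : topologicalType) (f : X -> Y) (g : X -> Z) x :
  {for x, continuous f} -> {for x, continuous g} ->
  {for x, continuous (fun y => (f y, g y))}.
Proof.
move=> cf cg; apply: (@cvg_pair _ _ _ (nbhs x) (nbhs (f x)) (nbhs (g x))) => //.
Qed.

Section borel_rV.
Context {R : realType}.

Lemma rV_norm_ltP d (x : 'rV[R]_d) (e : R) : 0 < e ->
  reflect (forall i, `|x ord0 i| < e) (`|x| < e).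
Proof.
move=> e0; apply: (iffP idP) => [xe i|xe].
  apply: le_lt_trans xe; rewrite [leRHS]/Num.norm/= mx_normrE.
  exact: (le_bigmax _ (fun i : 'I_1 * 'I_d => `|x i.1 i.2|) (ord0, i)).
rewrite [ltLHS]/Num.norm/= mx_normrE; apply/bigmax_ltP; split => // i _.
by rewrite (ord1 i.1) xe.
Qed.

Lemma rV_norm_leP d (x : 'rV[R]_d) (e : R) : 0 <= e ->
  reflect (forall i, `|x ord0 i| <= e) (`|x| <= e).
Proof.
move=> e0; apply: (iffP idP) => [xe i|xe].
  apply: le_trans xe; rewrite [leRHS]/Num.norm/= mx_normrE.
  exact: (le_bigmax _ (fun i : 'I_1 * 'I_d => `|x i.1 i.2|) (ord0, i)).
rewrite [leLHS]/Num.norm/= mx_normrE; apply/bigmax_leP; split => // i _.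
by rewrite (ord1 i.1) xe.
Qed.

Lemma measurable_rV_ball d (c : 'rV[R]_d) (e : R) :
  measurable [set x : 'rV[R]_d | `|x - c| < e].
Proof.
have [e0|e0] := leP e 0.
  rewrite (_ : [set _ | _] = set0)//; apply/seteqP; split => // x /=.
  by move=> /lt_le_trans/(_ e0); rewrite normr_lt0.
rewrite (_ : [set _ | _] = \bigcap_(i : 'I_d)
    ((fun x : 'rV[R]_d => x ord0 i) @^-1` [set y | `|y - c ord0 i| < e])).
  apply: fin_bigcap_measurable; first exact: finite_finset.
  move=> i _; rewrite -[X in measurable X]setTI.
  apply: measurable_coord => //.
  rewrite (_ : [set _ | _] = ball (c ord0 i) e).
    by apply: open_measurable; exact: ball_open.
  by apply/seteqP; split => y; rewrite /ball/= distrC.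
apply/seteqP; split => x /=.
  by move=> /(rV_norm_ltP _ e0) xe i _ /=; have := xe i; rewrite !mxE.
by move=> xe; apply/rV_norm_ltP => // i; rewrite !mxE; exact: xe.
Qed.

(** An open set is the union of the balls with rational centre and radius 1 /
    (n + 1) that it contains. These are countably many, and each ball of the
    sup norm is a finite intersection of preimages of intervals by the
    coordinates. *)
Lemma open_measurable_rV d (U : set 'rV[R]_d) : open U -> measurable U.
Proof.
move=> oU.
pose B (z : 'rV[rat]_d * nat) :=
  [set x : 'rV[R]_d | `|x - map_mx ratr z.1| < z.2.+1%:R^-1].
have -> : U = \bigcup_(z in [set z | B z `<=` U]) B z.
  apply/seteqP; split => x; last by move=> [z /= zU Bx]; exact: zU.
  move=> Ux.
  have /nbhs_ballP[e /= e0 eU] : nbhs x U by exact: open_nbhs_nbhs.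
  have [n ne] : exists n : nat, n.+1%:R^-1 + n.+1%:R^-1 < e.
    have e20 : 0 < e / 2 by rewrite divr_gt0.
    have [n _ ne] := @near_infty_natSinv_lt R (PosNum e20).
    by exists n; rewrite [ltRHS]splitr ltrD//; exact: (ne n (leqnn n)).
  have q_ i : exists q : rat, `|x ord0 i - ratr q| < n.+1%:R^-1.
    have /rat_in_itvoo[q] : x ord0 i < x ord0 i + n.+1%:R^-1 by rewrite ltrDl invr_gt0.
    rewrite in_itv/= => /andP[xq qx]; exists q.
    by rewrite distrC ger0_norm ?subr_ge0 1?ltW// ltrBlDl.
  have [q qP] := choice q_.
  have n0 : 0 < n.+1%:R^-1 :> R by rewrite invr_gt0.
  have Bx : B (\row_i q i, n) x.
    by apply/rV_norm_ltP => // i; rewrite !mxE/=.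
  exists (\row_i q i, n) => //= y By; apply: eU.
  rewrite mx_norm_ball /ball_/=; apply: le_lt_trans ne.
  rewrite -(subrK (map_mx ratr (\row_i q i)) x) -addrA.
  apply: le_trans (ler_normD _ _) _; rewrite lerD//; first exact: ltW.
  by rewrite distrC; exact: ltW.
rewrite bigcup_mkcond; apply: countable_bigcupT_measurable => [|z].
  exact: countableP.
by case: ifPn => // _; exact: measurable_rV_ball.
Qed.

Lemma continuous_measurable_rV d (f : 'rV[R]_d -> R) :
  continuous f -> measurable_fun setT f.
Proof.
move=> cf; apply: (measurability _ (RGenOpens.measurableE R)).
move=> _ [_ [a [b ->] <-]]; rewrite setTI; apply: open_measurable_rV.
by move/continuousP : cf; apply; exact: interval_open.
Qed.

Lemma continuous_rV (X : topologicalType) d (f : X -> 'rV[R]_d) x :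
  (forall i, {for x, continuous (fun y => f y ord0 i)}) ->
  {for x, continuous f}.
Proof.
move=> cf; apply/(@cvgrPdist_lt _ _ _ (nbhs x)) => e e0; near=> y.
apply/rV_norm_ltP => // i; rewrite !mxE; move: i; near: y.
apply: filter_forall => i; rewrite near_simpl.
have /cvgrPdist_lt := cf i.
exact.
Unshelve. all: by end_near. Qed.

(** The sigma-algebra on the left is a product one; the bijection [rV_cons]
    brings the claim back to Borel functions on R^(d+1). *)
Lemma continuous_measurable_rVX d (f : 'rV[R]_d * R -> R) :
  continuous f -> measurable_fun [set: 'rV[R]_d * measurableTypeR R] f.
Proof.
move=> cf.
pose g (x : 'rV[R]_d.+1) := f (\row_(i < d) x ord0 (lift ord0 i), x ord0 ord0).
have cg : continuous g.
  move=> x; apply: (@continuous_comp _ _ _ (fun x : 'rV[R]_d.+1 =>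
    (\row_(i < d) x ord0 (lift ord0 i), x ord0 ord0)) f); last exact: cf.
  apply: continuous_pair.
    apply: continuous_rV => i.
    rewrite (_ : (fun _ => _) = (fun x : 'rV[R]_d.+1 => x ord0 (lift ord0 i))); last first.
      by apply/funext => z; rewrite mxE.
    exact: (@coord_continuous R 1 d.+1 ord0 (lift ord0 i) x).
  exact: (@coord_continuous R 1 d.+1 ord0 ord0 x).
have -> : f = g \o @rV_cons R d \o (fun z => (z.2, z.1)).
  apply/funext => -[x t]; rewrite /g/=.
  have := rV_consK (t : measurableTypeR R, x).
  by rewrite /rV_uncons => -[-> ->].
apply: measurableT_comp.
  apply: measurableT_comp; first exact: continuous_measurable_rV.
  exact: measurable_rV_cons.
by apply: measurable_fun_pair.
Qed.

End borel_rV.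

(** * Integration over R^d *)

Lemma bounded_support_integrable d (T : measurableType d) (R : realType)
    (mu : {measure set T -> \bar R}) (A : set T) (f : T -> R) (M : R) :
  measurable A -> (mu A < +oo)%E -> measurable_fun setT f ->
  (forall x, A x -> `|f x| <= M) -> (forall x, ~ A x -> f x = 0) ->
  mu.-integrable setT (EFin \o f).
Proof.
move=> mA Aoo mf fM f0.
have -> : EFin \o f = (EFin \o f) \_ A.
  apply/funext => x; rewrite patchE; case: ifPn => //.
  by rewrite notin_setE => /f0 /= ->.
rewrite -integrable_mkcond//.
apply: measurable_bounded_integrable => //; first exact: measurable_funTS.
exists M; split; first exact: num_real.
by move=> x Mx y Ay; apply: le_trans (fM y Ay) (ltW Mx).
Qed.

(** The positive part of f is at most g, and the negative part only decreases
    the integral of f, even when it is infinite. *)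
Lemma le_integral_ge0 d (T : measurableType d) (R : realType)
    (mu : {measure set T -> \bar R}) (D : set T) (f g : T -> \bar R) :
  measurable D -> measurable_fun D f -> measurable_fun D g ->
  (forall x, D x -> 0 <= g x)%E -> (forall x, D x -> f x <= g x)%E ->
  (\int[mu]_(x in D) f x <= \int[mu]_(x in D) g x)%E.
Proof.
move=> mD mf mg g0 fg; rewrite integralE.
apply: (@le_trans _ _ (\int[mu]_(x in D) f^\+ x)%E).
  by rewrite geeDl// oppe_le0 integral_ge0.
apply: ge0_le_integral => //; first exact: measurable_funepos.
by move=> x Dx; rewrite funeposE ge_max fg// g0.
Qed.

(** The negative part of f is at most g, and the positive part only increases
    the integral of f. *)
Lemma oppe_integral_le d (X : measurableType d) (R : realType)
    (mu : {measure set X -> \bar R}) (f g : X -> \bar R) :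
  measurable_fun setT f -> measurable_fun setT g ->
  (forall x, 0 <= g x)%E -> (forall x, - f x <= g x)%E ->
  (- (\int[mu]_x g x) <= \int[mu]_x f x)%E.
Proof.
move=> mf mg g0 fg; rewrite [leRHS]integralE.
apply: (@le_trans _ _ (- (\int[mu]_x f^\- x))%E); last first.
  by rewrite leeDr// integral_ge0.
rewrite leeN2; apply: ge0_le_integral => //; first exact: measurable_funeneg.
by move=> x _; rewrite funenegE ge_max fg g0.
Qed.

Section lebesgue_rV.
Context {R : realType}.

Lemma measurable_rV_cball d (B : R) : measurable [set x : 'rV[R]_d | `|x| <= B].
Proof.
have /continuous_measurable_rV := @norm_continuous R 'rV[R]_d.
move=> /(_ measurableT `]-oo, B]%classic); rewrite setTI => h.
rewrite (_ : [set _ | _] = (fun x : 'rV[R]_d => `|x|) @^-1` `]-oo, B]).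
  exact: h (measurable_itv _).
by apply/seteqP; split => x /=; rewrite in_itv.
Qed.

Lemma rV_cons_cballE d (B : R) : 0 <= B ->
  @rV_cons R d @^-1` [set x | `|x| <= B] = `[- B, B] `*` [set x | `|x| <= B].
Proof.
move=> B0; apply/seteqP; split => -[a y] /=.
  move=> /(rV_norm_leP _ B0) h; split.
    by have := h ord0; rewrite mxE unlift_none/= in_itv/= ler_norml.
  by apply/rV_norm_leP => // i; have := h (lift ord0 i); rewrite mxE liftK/=.
rewrite in_itv/= -ler_norml => -[aB /(rV_norm_leP _ B0) h].
apply/rV_norm_leP => // i; rewrite mxE/=.
by case: unliftP => [j _|_] //=; exact: h.
Qed.

(** A ball of the sup norm is a product of intervals. *)
Lemma lebesgue_rV_cball_lty d (B : R) :
  (lebesgue_rV d [set x : 'rV[R]_d | (`|x| <= B)%R] < +oo)%E.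
Proof.
have [B0|B0] := leP 0 B; last first.
  rewrite (_ : [set _ | _] = set0) ?measure0//.
  apply/seteqP; split => // x /= /le_lt_trans/(_ B0).
  by rewrite normr_lt0.
elim: d => [|d IH].
  by rewrite /= diracE; case: (_ \in _); rewrite ltry.
rewrite /= /lebesgue_step /pushforward rV_cons_cballE//.
rewrite product_measure1E//; last exact: measurable_rV_cball.
rewrite lte_mul_pinfty//.
by rewrite /= lebesgue_measure_itv/=; case: ifPn.
Qed.

Lemma compact_rV_cball d (B : R) : compact [set x : 'rV[R]_d | `|x| <= B].
Proof.
apply: bounded_closed_compact.
  by exists B; split => [|x Bx y /= yB]; rewrite ?num_real// (le_trans yB)// ltW.
rewrite (_ : [set _ | _] = (fun x : 'rV[R]_d => `|x|) @^-1` [set x | x <= B])//.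
by apply: closed_comp; [move=> x _; exact: norm_continuous|exact: closed_le].
Qed.

Lemma cball_support_integrable d (B : R) (f : 'rV[R]_d -> R) :
  continuous f -> (forall x, B < `|x| -> f x = 0) ->
  (lebesgue_rV d).-integrable setT (EFin \o f).
Proof.
move=> cf f0.
have [M [_ MB]] : bounded_set (f @` [set x : 'rV[R]_d | `|x| <= B]).
  apply: compact_bounded; apply: continuous_compact; last exact: compact_rV_cball.
  exact: continuous_subspaceT.
apply: (@bounded_support_integrable _ _ R (lebesgue_rV d)
  [set x : 'rV[R]_d | `|x| <= B] f (M + 1)).
- exact: measurable_rV_cball.
- exact: lebesgue_rV_cball_lty.
- exact: continuous_measurable_rV.
- by move=> x xB; apply: (MB (M + 1)); [rewrite ltrDl|exists x].
- by move=> x /negP; rewrite -ltNge; exact: f0.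
Qed.

Lemma integrable_rV_cons d (f : 'rV[R]_d.+1 -> \bar R) :
  (lebesgue_rV d.+1).-integrable setT f ->
  (lebesgue_measure \x lebesgue_rV d)%E.-integrable setT (f \o @rV_cons R d).
Proof.
move=> /integrableP[mf foo]; apply/integrableP; split.
  by apply: measurableT_comp => //; exact: measurable_rV_cons.
have := @ge0_integral_pushforward _ _ _ _ R (@rV_cons R d)
  (@measurable_rV_cons R d) (lebesgue_measure \x lebesgue_rV d)%E setT (abse \o f).
rewrite preimage_setT => <- //; first exact: measurableT_comp.
by move=> y _; exact: abse_ge0.
Qed.

(** [lebesgue_rV] is defined by recursion on the dimension as the image of a
    product measure; in this form Fubini's theorem applies to it. *)
Lemma integral_rV_cons d (f : 'rV[R]_d.+1 -> \bar R) :
  (lebesgue_rV d.+1).-integrable setT f ->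
  (\int[lebesgue_rV d.+1]_x f x =
   \int[lebesgue_measure \x lebesgue_rV d]_z f (rV_cons z))%E.
Proof.
move=> intf; have mf := measurable_int _ intf.
have := @integral_pushforward _ _ _ _ R (@rV_cons R d)
  (@measurable_rV_cons R d) (lebesgue_measure \x lebesgue_rV d)%E setT f mf.
rewrite preimage_setT => <-//; exact: integrable_rV_cons.
Qed.

Lemma ge0_integral_rV_cons d (f : 'rV[R]_d.+1 -> \bar R) :
  measurable_fun setT f -> (forall x, 0 <= f x)%E ->
  (\int[lebesgue_rV d.+1]_x f x =
   \int[lebesgue_measure \x lebesgue_rV d]_z f (rV_cons z))%E.
Proof.
move=> mf f0.
have := @ge0_integral_pushforward _ _ _ _ R (@rV_cons R d)
  (@measurable_rV_cons R d) (lebesgue_measure \x lebesgue_rV d)%E setT f.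
by rewrite preimage_setT => <-.
Qed.

End lebesgue_rV.

(** * The divergence theorem for compactly supported fields *)

Section derive_comp.
Context {R : realType}.

Section affine.
Context {U V W : normedModType R} (f : V -> W) (c : U -> V) (x u : U) (v : V).
Hypothesis cE : forall h : R, c (h *: u + x) = h *: v + c x.

Let quotE : (fun h : R => h^-1 *: ((f \o c \o shift x) (h *: u) - (f \o c) x)) =
  (fun h : R => h^-1 *: ((f \o shift (c x)) (h *: v) - f (c x))).
Proof. by apply/funext => h /=; rewrite cE. Qed.

(** The two difference quotients are equal. This serves for slices such as a
    |-> F (a, y) and for partial maps such as p |-> H (x, p). *)
Lemma derivable_comp_affine :
  derivable f (c x) v -> derivable (f \o c) x u.
Proof. by rewrite /derivable quotE. Qed.

Lemma derive_comp_affine : 'D_u (f \o c) x = 'D_v f (c x).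
Proof. by rewrite /derive quotE. Qed.

End affine.

End derive_comp.

Section divergence_theorem.
Context {R : realType}.

Lemma derive_eq0_near (V : normedModType R) (F : V -> R) (x v : V) :
  (\forall y \near x, F y = 0) -> 'D_v F x = 0.
Proof.
move=> F0; rewrite (@near_eq_derive _ _ _ F (cst 0)) ?derive_cst//.
Qed.

Lemma partial_support d (i : 'I_d) (B : R) (F : 'rV[R]_d -> R) :
  (forall x, B < `|x| -> F x = 0) ->
  forall x, B < `|x| -> partial i F x = 0.
Proof.
move=> F0 x Bx; apply: derive_eq0_near.
have /(_ x) := @norm_continuous R 'rV[R]_d.
move=> /cvgr_gt/(_ _ Bx); apply: filterS => y; exact: F0.
Qed.

Lemma rV_cons_shiftl d (a h : R) (y : 'rV[R]_d) :
  rV_cons (h *: (1 : R) + a : measurableTypeR R, y) =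
  h *: delta_mx ord0 ord0 + rV_cons (a : measurableTypeR R, y).
Proof.
apply/rowP => i; rewrite !mxE/=; case: unliftP => [j ->|->] /=.
  by rewrite mulr0 add0r.
by rewrite mulr1 [h *: 1]mulr1.
Qed.

Lemma rV_cons_shiftr d (j : 'I_d) (a h : R) (y : 'rV[R]_d) :
  rV_cons (a : measurableTypeR R, h *: delta_mx ord0 j + y) =
  h *: delta_mx ord0 (lift ord0 j) + rV_cons (a : measurableTypeR R, y).
Proof.
apply/rowP => i; rewrite !mxE/=; case: unliftP => [k ->|->] /=.
  by rewrite !mxE (inj_eq (lift_inj (h := ord0))).
by rewrite mulr0 add0r.
Qed.

Lemma continuous_rV_consl d (y : 'rV[R]_d) :
  continuous (fun a : R => rV_cons (a : measurableTypeR R, y)).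
Proof.
move=> a; apply: continuous_rV => i.
rewrite (_ : (fun _ => _) = fun a : R => oapp (y ord0) a (unlift ord0 i)); last first.
  by apply/funext => b; rewrite mxE.
by case: unliftP => [j _|_] /=; [exact: cst_continuous|exact: cvg_id].
Qed.

Lemma continuous_rV_consr d (a : R) :
  continuous (fun y : 'rV[R]_d => rV_cons (a : measurableTypeR R, y)).
Proof.
move=> y; apply: continuous_rV => i.
rewrite (_ : (fun _ => _) = fun y : 'rV[R]_d => oapp (y ord0) a (unlift ord0 i)); last first.
  by apply/funext => b; rewrite mxE.
by case: unliftP => [j _|_] /=; [exact: coord_continuous|exact: cst_continuous].
Qed.

Lemma rV_cons_norml d (a : R) (y : 'rV[R]_d) :
  `|a| <= `|rV_cons (a : measurableTypeR R, y)|.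
Proof.
have /rV_norm_leP/(_ ord0) := lexx `|rV_cons (a : measurableTypeR R, y)|.
by rewrite mxE unlift_none/=; apply.
Qed.

Lemma rV_cons_normr d (a : R) (y : 'rV[R]_d) :
  `|y| <= `|rV_cons (a : measurableTypeR R, y)|.
Proof.
apply/rV_norm_leP => // i.
have /rV_norm_leP/(_ (lift ord0 i)) := lexx `|rV_cons (a : measurableTypeR R, y)|.
by rewrite mxE liftK/=; apply.
Qed.

Lemma integral_derive1_eq0 (f : R -> R) (B : R) :
  (forall a, derivable f a 1) -> continuous (derive1 f) ->
  (forall a, B < `|a| -> f a = 0) ->
  (\int[lebesgue_measure]_a (derive1 f a)%:E = 0)%E.
Proof.
move=> df cf f0; pose b := Num.max B 0 + 1.
have Bb : B < b by rewrite ltr_pwDr// le_max lexx.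
have b0 : 0 < b by rewrite ltr_pwDr// le_max lexx orbT.
have cvgf x : f y @[y --> x] --> f x.
  by apply: differentiable_continuous; exact/derivable1_diffP.
have : (\int[lebesgue_measure]_(a in `[(- b)%R, b]) (derive1 f a)%:E = 0)%E.
  rewrite (@continuous_FTC2 _ _ f).
  - by rewrite !f0 ?subee// ?normrN gtr0_norm.
  - by rewrite gtrN.
  - exact: continuous_subspaceT.
  - split; first by move=> x _; exact: df.
    + exact: cvg_at_right_filter.
    + exact: cvg_at_left_filter.
  - by move=> x.
rewrite integral_mkcond => <-; apply: eq_integral => a _.
rewrite patchE; case: ifPn => //; rewrite notin_setE/= in_itv/= -ler_norml.
move=> /negP; rewrite -ltNge => ba; rewrite derive1E derive_eq0_near//.
have /(_ a) := @norm_continuous R R.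
move=> /cvgr_gt/(_ _ ba); apply: filterS => y /(lt_trans Bb); exact: f0.
Qed.

(** Fubini's theorem and the fundamental theorem of calculus along the i-th
    axis. The induction peels off the first coordinate: if it is the i-th one,
    then the inner integral over it vanishes; otherwise the induction
    hypothesis applies to the slices. *)
Lemma integral_partial d (i : 'I_d) (F : 'rV[R]_d -> R) (B : R) :
  (forall x, derivable F x (delta_mx ord0 i)) -> continuous (partial i F) ->
  (forall x, B < `|x| -> F x = 0) ->
  (\int[lebesgue_rV d]_x (partial i F x)%:E = 0)%E.
Proof.
elim: d => [|d IH] in i F *; first by case: i.
move=> dF cF F0.
have iF := cball_support_integrable cF (partial_support i F0).
rewrite integral_rV_cons//; have icF := integrable_rV_cons iF.
case: (unliftP ord0 i) => [j ij|i0].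
  rewrite -integral12_prod_meas1//; apply: integral0_eq => a _.
  rewrite -[RHS](IH j (fun y => F (rV_cons (a : measurableTypeR R, y)))).
  - apply: eq_integral => y _ /=; congr EFin; rewrite ij; apply/esym.
    by apply: derive_comp_affine => h; exact: rV_cons_shiftr.
  - move=> y; apply: (@derivable_comp_affine _ _ _ _ F _ _ _ (delta_mx ord0 i)) => //.
    by move=> h; rewrite ij; exact: rV_cons_shiftr.
  - rewrite (_ : partial _ _ = partial i F \o (fun y => rV_cons (a : measurableTypeR R, y))).
      by move=> y; apply: continuous_comp; [exact: continuous_rV_consr|exact: cF].
    apply/funext => y; rewrite ij.
    by apply: derive_comp_affine => h; exact: rV_cons_shiftr.
  - by move=> y By; apply: F0; exact: lt_le_trans By (rV_cons_normr _ _).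
rewrite -integral21_prod_meas1//; apply: integral0_eq => y _.
have dE : derive1 (fun a : R => F (rV_cons (a : measurableTypeR R, y))) =
    partial i F \o (fun a : R => rV_cons (a : measurableTypeR R, y)).
  apply/funext => a; rewrite derive1E i0.
  by apply: derive_comp_affine => h; exact: rV_cons_shiftl.
rewrite -[RHS](@integral_derive1_eq0 (fun a : R => F (rV_cons (a : measurableTypeR R, y))) B).
- by rewrite dE.
- move=> a; apply: (@derivable_comp_affine _ _ _ _ F _ _ _ (delta_mx ord0 i)) => //.
  by move=> h; rewrite i0; exact: rV_cons_shiftl.
- rewrite dE => a.
  by apply: continuous_comp; [exact: continuous_rV_consl|exact: cF].
- by move=> a Ba; apply: F0; exact: lt_le_trans Ba (rV_cons_norml _ _).
Qed.

End divergence_theorem.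

(** * Pointwise calculus *)

Section scalar.
Context {R : realType}.

(** Brings directional derivatives back to functions of one real variable, so
    that the chain rule below follows from the one-variable chain rule. *)
Lemma is_derive_line (V W : normedModType R) (f : V -> W) (x v : V) (df : W) :
  is_derive x v f df <-> is_derive (0 : R) 1 (fun h => f (h *: v + x)) df.
Proof.
have E : (fun h : R => h^-1 *: ((f \o shift x) (h *: v) - f x)) =
  (fun h : R => h^-1 *: (((fun h => f (h *: v + x)) \o shift 0) (h *: 1) - f (0 *: v + x))).
  by apply/funext => h; rewrite /= addr0 scale0r add0r [h *: 1]mulr1.
by split=> -[d1 d2]; split; move: d1 d2; rewrite /derivable /derive E.
Qed.

Lemma is_derive_scalar_comp (V : normedModType R) (f : V -> R) (g : R -> R)
    (x v : V) (df dg : R) :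
  is_derive x v f df -> is_derive (f x) 1 g dg ->
  is_derive x v (g \o f) (dg * df).
Proof.
move=> /is_derive_line f' g'; apply/is_derive_line.
apply: (@is_derive1_comp _ g (fun h => f (h *: v + x))) => //.
by rewrite scale0r add0r.
Qed.

Lemma is_derive_coord d (x v : 'rV[R]_d) j :
  is_derive x v (fun y : 'rV[R]_d => y ord0 j) (v ord0 j).
Proof.
apply/is_derive_line.
rewrite (_ : (fun h : R => _) = fun h => h * v ord0 j + x ord0 j); last first.
  by apply/funext => h; rewrite !mxE.
apply: is_derive_eq.
by rewrite addr0 scaler0 add0r [_ *: 1]mulr1.
Qed.

Section pointwise.
Context {X : topologicalType} (f g : X -> R) (x : X).
Hypotheses (cf : continuous_at x f) (cg : continuous_at x g).

Lemma continuous_mul : continuous_at x (fun y => f y * g y).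
Proof. exact: continuousM. Qed.

Lemma continuous_add : continuous_at x (fun y => f y + g y).
Proof. exact: (@continuousD _ _ _ f g). Qed.

Lemma continuous_sub : continuous_at x (fun y => f y - g y).
Proof. exact: (@continuousB _ _ _ f g). Qed.

End pointwise.

Lemma continuous_sum (X : topologicalType) n (F : 'I_n -> X -> R) x :
  (forall i, continuous_at x (F i)) ->
  continuous_at x (fun y => \sum_i F i y).
Proof.
move=> cF; apply: (@cvg_big R _ +%R 0 xpredT _ _ (nbhs x) _ F (F ^~ x)).
  exact: add_continuous.
by move=> i _; exact: cF.
Qed.

(** From the exponent 3 on, these powers of the positive part are of class C^2,
    as a test function for a second-order equation has to be. *)
Definition posX (k : nat) (y : R) := Num.max y 0 ^+ k.

Lemma posX_ge0 k y : 0 <= posX k y.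
Proof. by rewrite exprn_ge0// le_max lexx orbT. Qed.

Lemma posX_eq0 k (y : R) : y <= 0 -> posX k.+1 y = 0.
Proof. by move=> y0; rewrite /posX max_r// expr0n. Qed.

Lemma continuous_posX k : continuous (posX k).
Proof.
move=> y; rewrite /posX (_ : (fun _ => _) = (fun y => y ^+ k) \o (fun y : R => Num.max y 0))//.
apply: continuous_comp; last exact: exprn_continuous.
by apply: continuous_max; [exact: cvg_id|exact: cst_continuous].
Qed.

Lemma is_derive_posX k (y : R) :
  is_derive y 1 (posX k.+2) (k.+2%:R * posX k.+1 y).
Proof.
have [y0|y0|<-] := ltgtP 0 y.
- apply: (@near_eq_is_derive R R R (fun y => y ^+ k.+2)).
    near=> z; rewrite /posX max_l// ltW//; near: z; exact: lt_nbhsr.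
  rewrite /posX max_l ?ltW//.
  have := @is_deriveX R R id k.+2 y 1 1 (is_derive_id _ _).
  rewrite [_ *: 1]mulr1; congr is_derive.
  by apply/funext => z; rewrite exprfctE.
- apply: (@near_eq_is_derive R R R (cst 0)).
    near=> z; rewrite /posX max_r ?expr0n// ltW//; near: z; exact: lt_nbhsl.
  by rewrite /posX max_r ?ltW// expr0n mulr0; exact: is_derive_cst.
- have -> : k.+2%:R * posX k.+1 0 = 0 :> R by rewrite /posX max_r// expr0n mulr0.
  have cv : h^-1 *: ((posX k.+2 \o shift 0) (h *: 1) - posX k.+2 0) @[h --> (0:R)^'] --> (0 : R).
    apply/cvgrPdist_le => e e0; near=> h.
    have h0 : h != 0 by near: h; exact: nbhs_dnbhs_neq.
    rewrite sub0r normrN /= addr0 [h *: 1]mulr1 /posX maxxx [0 ^+ _]expr0n subr0.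
    rewrite normrM normfV normrX.
    have hm : `|Num.max h 0| <= `|h|.
      by rewrite /Num.max; case: ifP => _; rewrite ?normr0.
    rewrite ler_pdivrMl ?normr_gt0//.
    apply: (@le_trans _ _ (`|h| ^+ k.+2)); first by rewrite lerXn2r ?nnegrE.
    rewrite exprS ler_wpM2l//.
    apply: (@le_trans _ _ `|h|).
      rewrite exprS ler_piMr// exprn_ile1// ltW//; near: h.
      by apply: dnbhs0_lt.
    by near: h; exact: dnbhs0_le.
  by split; [apply/cvg_ex; exists 0|exact/cvg_lim].
Unshelve. all: by end_near. Qed.

End scalar.

(** * A logarithmic weight and its truncations *)

Section cutoff.
Context {R : realType}.

(** A profile that grows slowly enough to have bounded first and second
    derivatives, and fast enough for exp (- ln1sqr y) = 1 / (1 + y^2) to be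
    integrable. *)
Definition ln1sqr (y : R) := ln (1 + y ^+ 2).
Definition dln1sqr (y : R) := 2 * y / (1 + y ^+ 2).
Definition ddln1sqr (y : R) := 2 * (1 - y ^+ 2) / (1 + y ^+ 2) ^+ 2.

Lemma add1sqr_gt0 (y : R) : 0 < 1 + y ^+ 2.
Proof. by rewrite ltr_pwDl// sqr_ge0. Qed.

Lemma ln1sqr_ge0 y : 0 <= ln1sqr y.
Proof. by rewrite ln_ge0// lerDl sqr_ge0. Qed.

Lemma is_derive_add1sqr (y : R) : is_derive y 1 (fun y => 1 + y ^+ 2) (2 * y).
Proof.
by apply: is_derive_eq; rewrite [y%:A]mulr1; ring.
Qed.

Lemma is_derive_ln1sqr (y : R) : is_derive y 1 ln1sqr (dln1sqr y).
Proof.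
have := @is_derive1_comp _ (@ln R) (fun y => 1 + y ^+ 2) y _ _
  (is_derive1_ln (add1sqr_gt0 y)) (is_derive_add1sqr y).
by rewrite mulrC.
Qed.

Lemma is_derive_dln1sqr (y : R) : is_derive y 1 dln1sqr (ddln1sqr y).
Proof.
have n0 := lt0r_neq0 (add1sqr_gt0 y).
have h1 : is_derive y 1 (fun y : R => 2 * y) 2.
  by apply: is_derive_eq; rewrite [_%:A]mulr1.
have h2 := @is_deriveV R (fun y => 1 + y ^+ 2) y _ _ n0 (is_derive_add1sqr y).
have := is_deriveM h1 h2.
rewrite (_ : (fun y : R => 2 * y) * _ = dln1sqr); last by apply/funext.
congr is_derive; rewrite /ddln1sqr /GRing.scale/= expr2; field.
exact: n0.
Qed.

Lemma abs_dln1sqr_le y : `|dln1sqr y| <= 1.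
Proof.
rewrite /dln1sqr normrM normfV (gtr0_norm (add1sqr_gt0 _)) ler_pdivrMr ?add1sqr_gt0//.
rewrite mul1r ler_norml; have := sqr_ge0 (y + 1); have := sqr_ge0 (y - 1).
by rewrite sqrrB sqrrD => h1 h2; apply/andP; split; lra.
Qed.

Lemma abs_ddln1sqr_le y : `|ddln1sqr y| <= 2.
Proof.
rewrite /ddln1sqr normrM normfV.
rewrite (@gtr0_norm _ ((1 + y ^+ 2) ^+ 2)) ?exprn_gt0 ?add1sqr_gt0//.
rewrite ler_pdivrMr ?exprn_gt0 ?add1sqr_gt0//.
have := sqr_ge0 y; set s := y ^+ 2 => s0.
by rewrite ler_norml; apply/andP; split; nra.
Qed.

Lemma continuous_ln1sqr : continuous ln1sqr.
Proof.
move=> y; apply/differentiable_continuous/derivable1_diffP.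
by case: (is_derive_ln1sqr y).
Qed.

Lemma continuous_dln1sqr : continuous dln1sqr.
Proof.
move=> y; apply/differentiable_continuous/derivable1_diffP.
by case: (is_derive_dln1sqr y).
Qed.

Lemma continuous_ddln1sqr : continuous ddln1sqr.
Proof.
rewrite /ddln1sqr => y; apply: continuous_mul.
  apply: continuous_mul; first exact: cst_continuous.
  by apply: continuous_sub; [exact: cst_continuous|exact: exprn_continuous].
apply: (@cvgV _ _ (nbhs y)); first by rewrite lt0r_neq0// exprn_gt0// add1sqr_gt0.
have := @continuous_comp _ _ _ (fun y : R => 1 + y ^+ 2) (fun z => z ^+ 2) y.
apply; [exact: continuous_oneDsqr|exact: exprn_continuous].
Qed.

Section rV.
Context {d : nat}.
Implicit Types x : 'rV[R]_d.

(** As a sum over the coordinates instead of a function of the Euclidean norm,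
    it makes exp (- weight) a product, and each of its partial derivatives
    depends on one coordinate only. *)
Definition weight x := \sum_i ln1sqr (x ord0 i).

Lemma weight_ge0 x : 0 <= weight x.
Proof. by rewrite sumr_ge0// => i _; exact: ln1sqr_ge0. Qed.

Lemma continuous_weight : continuous weight.
Proof.
move=> x; apply: continuous_sum => i.
apply: (@continuous_comp _ _ _ (fun x => x ord0 i) ln1sqr).
  exact: coord_continuous.
exact: continuous_ln1sqr.
Qed.

Lemma is_derive_weight i x :
  is_derive x (delta_mx ord0 i) weight (dln1sqr (x ord0 i)).
Proof.
have -> : weight = \sum_j (ln1sqr \o (fun x => x ord0 j)).
  by apply/funext => y; rewrite /weight fct_sumE.
have := @is_derive_sum _ _ _ _ (fun j => ln1sqr \o (fun x => x ord0 j)) x (delta_mx ord0 i)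
  (fun j => dln1sqr (x ord0 j) * (delta_mx ord0 i : 'rV[R]_d) ord0 j)
  (fun j => is_derive_scalar_comp (is_derive_coord _ _ _) (is_derive_ln1sqr _)).
congr is_derive.
rewrite (bigD1 i)//= mxE !eqxx mulr1 big1 ?addr0// => j ji.
by rewrite mxE (negbTE ji) andbF mulr0.
Qed.

(** A compactly supported function of class C^2 such that r - cutoff r is
    comparable to the weight truncated at height r, with first and second
    derivatives that are bounded uniformly in r >= 1. *)
Definition cutoff (r : R) x := posX 3 (r - weight x) / r ^+ 2.
Definition dcutoff (r : R) i x :=
  - 3 / r ^+ 2 * (posX 2 (r - weight x) * dln1sqr (x ord0 i)).
Definition ddcutoff (r : R) i x :=
  - 3 / r ^+ 2 * (posX 2 (r - weight x) * ddln1sqr (x ord0 i) -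
     2 * posX 1 (r - weight x) * dln1sqr (x ord0 i) ^+ 2).

Let is_derive_Bweight r i x :
  is_derive x (delta_mx ord0 i) (fun x => r - weight x) (- dln1sqr (x ord0 i)).
Proof.
have := @is_deriveB _ _ _ (cst r) weight x (delta_mx ord0 i) _ _
  (is_derive_cst _ _ _) (is_derive_weight i x).
by rewrite sub0r.
Qed.

Let is_derive_posX_weight r k i x :
  is_derive x (delta_mx ord0 i) (fun x => posX k.+2 (r - weight x))
    (k.+2%:R * posX k.+1 (r - weight x) * - dln1sqr (x ord0 i)).
Proof.
exact: (is_derive_scalar_comp (is_derive_Bweight r i x) (is_derive_posX k _)).
Qed.

Lemma is_derive_cutoff r i x :
  is_derive x (delta_mx ord0 i) (cutoff r) (dcutoff r i x).
Proof.
have := @is_deriveZ _ _ _ _ (r ^+ 2)^-1 _ _ _ (is_derive_posX_weight r 1 i x).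
rewrite (_ : _ \*: _ = cutoff r); last by apply/funext => y; rewrite /cutoff mulrC.
congr is_derive; rewrite /dcutoff /GRing.scale/=; ring.
Qed.

Lemma is_derive_dcutoff r i x :
  is_derive x (delta_mx ord0 i) (dcutoff r i) (ddcutoff r i x).
Proof.
have h1 := is_derive_scalar_comp (is_derive_coord x (delta_mx ord0 i) i)
  (is_derive_dln1sqr (x ord0 i)).
have := @is_deriveZ _ _ _ _ (- 3 / r ^+ 2) _ _ _
  (is_deriveM (is_derive_posX_weight r 0 i x) h1).
rewrite (_ : _ \*: _ = dcutoff r i)//.
congr is_derive; rewrite /ddcutoff /GRing.scale/= mxE !eqxx/=; ring.
Qed.

Let continuous_posX_weight r k : continuous (fun x => posX k (r - weight x)).
Proof.
move=> x; apply: (@continuous_comp _ _ _ (fun x => r - weight x) (posX k)).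
  by apply: continuous_sub; [exact: cst_continuous|exact: continuous_weight].
exact: continuous_posX.
Qed.

Let continuous_comp_coord (g : R -> R) i :
  continuous g -> continuous (fun x => g (x ord0 i)).
Proof.
move=> cg x; apply: (@continuous_comp _ _ _ (fun x => x ord0 i) g); last exact: cg.
exact: coord_continuous.
Qed.

Lemma continuous_cutoff r : continuous (cutoff r).
Proof.
rewrite /cutoff => x; apply: continuous_mul; last exact: cst_continuous.
exact: continuous_posX_weight.
Qed.

Lemma continuous_dcutoff r i : continuous (dcutoff r i).
Proof.
rewrite /dcutoff => x; apply: continuous_mul; first exact: cst_continuous.
apply: continuous_mul; first exact: continuous_posX_weight.
exact: (@continuous_comp_coord dln1sqr i continuous_dln1sqr x).
Qed.

Lemma continuous_ddcutoff r i : continuous (ddcutoff r i).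
Proof.
rewrite /ddcutoff => x; apply: continuous_mul; first exact: cst_continuous.
apply: continuous_sub; apply: continuous_mul.
- exact: continuous_posX_weight.
- exact: (@continuous_comp_coord ddln1sqr i continuous_ddln1sqr x).
- by apply: continuous_mul; [exact: cst_continuous|exact: continuous_posX_weight].
- apply: (@continuous_comp_coord (fun y => dln1sqr y ^+ 2)) => y.
  apply: (@continuous_comp _ _ _ dln1sqr (fun z => z ^+ 2)).
    exact: continuous_dln1sqr.
  exact: exprn_continuous.
Qed.

(** If |x_i| > exp r >= 1 then 1 + x_i^2 > exp r, so that a single coordinate
    suffices to make the weight larger than r. *)
Lemma weight_cball r x : 0 <= r -> expR r < `|x| -> r < weight x.
Proof.
move=> r0; rewrite ltNge => /negP xr.
have [i ri] : exists i, expR r < `|x ord0 i|.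
  apply/not_existsP => h; apply: xr; apply/rV_norm_leP; first exact: expR_ge0.
  by move=> i; rewrite leNgt; apply/negP/h.
apply: (@lt_le_trans _ _ (ln1sqr (x ord0 i))); last first.
  by rewrite /weight (bigD1 i)//= lerDl sumr_ge0// => j _; exact: ln1sqr_ge0.
rewrite /ln1sqr -ltr_expR lnK ?posrE ?add1sqr_gt0//.
have e1 : 1 <= expR r by rewrite -expR0 ler_expR.
rewrite -[X in _ < _ + X]real_normK ?num_real//.
nra.
Qed.

Lemma cutoff_support r x : 0 <= r -> expR r < `|x| -> cutoff r x = 0.
Proof.
move=> r0 /(weight_cball r0)/ltW h.
by rewrite /cutoff posX_eq0 ?mul0r// subr_le0.
Qed.

Let mpos r x : 0 <= r -> 0 <= Num.max (r - weight x) 0 <= r.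
Proof.
move=> r0; rewrite le_max lexx orbT ge_max r0 andbT.
by have := weight_ge0 x; lra.
Qed.

Lemma cutoff_ge0 r x : 0 <= cutoff r x.
Proof. by rewrite /cutoff divr_ge0// ?posX_ge0// sqr_ge0. Qed.

Lemma abs_dcutoff_le r i x : 0 < r -> `|dcutoff r i x| <= 3.
Proof.
move=> r0; have /andP[p0 pr] := mpos x (ltW r0).
rewrite /dcutoff normrM (normrM (- 3)) (normrM (posX _ _)) normfV normrN.
rewrite (gtr0_norm (exprn_gt0 2 r0)) (ger0_norm (posX_ge0 _ _)) (@ger0_norm _ 3)//.
have h1 := abs_dln1sqr_le (x ord0 i).
have n0 := normr_ge0 (dln1sqr (x ord0 i)).
rewrite mulrAC ler_pdivrMr ?exprn_gt0// ler_pM2l//.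
rewrite -[leRHS]mulr1 ler_pM// ?posX_ge0//.
by rewrite /posX lerXn2r// nnegrE// ltW.
Qed.

(** The two terms are bounded by 3 * 2 and by 3 * 2 / r, where r >= 1. *)
Lemma abs_ddcutoff_le r i x : 1 <= r -> `|ddcutoff r i x| <= 12.
Proof.
move=> r1; have r0 : 0 < r by lra.
have /andP[p0 pr] := mpos x (ltW r0).
have h1 := abs_dln1sqr_le (x ord0 i).
have h2 := abs_ddln1sqr_le (x ord0 i).
have n0 := normr_ge0 (dln1sqr (x ord0 i)).
rewrite /ddcutoff normrM (normrM (- 3)) normfV normrN (gtr0_norm (exprn_gt0 2 r0)).
rewrite (@ger0_norm _ 3)// mulrAC ler_pdivrMr ?exprn_gt0//.
rewrite [leRHS](_ : _ = 3 * (r ^+ 2 * 2 + 2 * r ^+ 2)); last by ring.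
rewrite ler_pM2l//.
apply: (le_trans (ler_normB _ _)); rewrite lerD//.
  rewrite (normrM (posX _ _)) (ger0_norm (posX_ge0 _ _)) ler_pM ?posX_ge0//.
  by rewrite /posX lerXn2r// nnegrE// ltW.
rewrite (normrM (2 * _)) (normrM 2) (@ger0_norm _ 2)// -mulrA ler_pM2l//.
rewrite (ger0_norm (posX_ge0 _ _)) /posX expr1 normrX.
have : `|dln1sqr (x ord0 i)| ^+ 2 <= 1 by rewrite exprn_ile1.
set q := _ ^+ 2; set p := Num.max _ _ => q1.
have : 0 <= q by rewrite sqr_ge0.
rewrite -/p in p0 pr *.
by move=> q0; nra.
Qed.

(** For y = weight x / r in [0, 1] this is 1 - (1 - y)^3 <= 3 y. *)
Lemma subr_cutoff_le r x : 0 < r -> r - cutoff r x <= 3 * weight x.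
Proof.
move=> r0; rewrite /cutoff; have w0 := weight_ge0 x.
have [wr|wr] := leP (weight x) r; last first.
  by rewrite posX_eq0 ?subr_le0 ?ltW// mul0r; lra.
rewrite /posX max_l ?subr_ge0//.
rewrite lerBlDr -lerBlDl ler_pdivlMr ?exprn_gt0//.
set w := weight x in w0 wr *.
(* (r - w)^3 - (r^3 - 3 r^2 w) = w^2 (3 r - w) *)
have : 0 <= w ^+ 2 * (3 * r - w) by apply: mulr_ge0; [exact: sqr_ge0|lra].
nra.
Qed.

(** For y = weight x / r in [0, 1] this is (1 - y)^3 <= 1 - y. *)
Lemma subr_cutoff_ge r x : 0 < r -> Num.min (weight x) r <= r - cutoff r x.
Proof.
move=> r0; rewrite /cutoff; have w0 := weight_ge0 x.
have [wr|wr] := leP (weight x) r; last first.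
  by rewrite posX_eq0 ?mul0r ?subr0// subr_le0 ltW.
rewrite lerBrDr -lerBrDl.
rewrite /posX max_l ?subr_ge0// ler_pdivrMr ?exprn_gt0//.
rewrite exprS ler_wpM2l ?subr_ge0// lerXn2r ?nnegrE ?subr_ge0 ?(ltW r0)//.
by rewrite lerBlDr lerDl.
Qed.

End rV.
End cutoff.

Section gibbs.
Context {R : realType}.

Lemma expRN_ln1sqr (y : R) : expR (- ln1sqr y) = (oneDsqr y)^-1.
Proof. by rewrite expRN lnK// posrE add1sqr_gt0. Qed.

Lemma integral_expRN_ln1sqr_lty :
  (\int[lebesgue_measure]_y (expR (- ln1sqr (y : R)))%:E < +oo)%E.
Proof.
under eq_integral do rewrite expRN_ln1sqr.
rewrite ge0_symfun_integralT.
- rewrite -set_itvcy integral0y_oneDsqr -EFinM ltry//.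
- by move=> y; rewrite invr_ge0 ltW// add1sqr_gt0.
- exact: continuous_oneDsqrV.
- by move=> y; rewrite /oneDsqr /= sqrrN.
Qed.

Lemma weight_cons d (a : measurableTypeR R) (y : 'rV[R]_d) :
  weight (rV_cons (a, y)) = ln1sqr a + weight y.
Proof.
rewrite /weight big_ord_recl mxE unlift_none/=; congr (_ + _).
by apply: eq_bigr => i _; rewrite mxE liftK.
Qed.

Lemma continuous_expRN_weight d : continuous (fun x : 'rV[R]_d => expR (- weight x)).
Proof.
move=> x; apply: (@continuous_comp _ _ _ (fun x : 'rV[R]_d => - weight x) expR).
  by apply: (@continuousN _ _ _ (@weight R d)); exact: continuous_weight.
exact: continuous_expR.
Qed.

(** By Tonelli's theorem the integral is the d-th power of the integral of 1 /
    (1 + y^2) over R. *)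
Lemma integral_expRN_weight_lty d :
  (\int[lebesgue_rV d]_x (expR (- weight x))%:E < +oo :> \bar R)%E.
Proof.
have mw n : measurable_fun [set: 'rV[R]_n] (fun x => (expR (- weight x))%:E).
  apply/(@measurable_EFinP _ _ _ _ (fun x => expR (- weight x))).
  by apply: continuous_measurable_rV; exact: continuous_expRN_weight.
elim: d => [|d IH].
  have -> : (\int[lebesgue_rV 0]_x (expR (- weight x))%:E =
      \int[\d_(0%R : 'rV[R]_0)]_x (expR (- weight x))%:E :> \bar R)%E by [].
  rewrite integral_dirac//; last exact: (mw 0).
  by rewrite /dirac indicE in_setT mul1e ltry.
rewrite (ge0_integral_rV_cons (mw d.+1)); last by move=> x; rewrite lee_fin expR_ge0.
rewrite fubini_tonelli1; last 2 first.
  apply: (measurableT_comp (mw d.+1)); exact: measurable_rV_cons.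
  by move=> x; rewrite lee_fin expR_ge0.
rewrite /fubini_F.
have -> : (fun a : measurableTypeR R =>
      \int[lebesgue_rV d]_y (expR (- weight (rV_cons (a, y))))%:E)%E =
    (fun a : measurableTypeR R =>
      (expR (- ln1sqr a))%:E * \int[lebesgue_rV d]_y (expR (- weight y))%:E)%E.
  apply/funext => a.
  under eq_integral do rewrite weight_cons opprD expRD EFinM.
  by rewrite ge0_integralZl//; exact: mw.
have mln1sqr : measurable_fun [set: measurableTypeR R] (fun a => (expR (- ln1sqr a))%:E).
  apply/(@measurable_EFinP _ _ _ _ (fun a => expR (- ln1sqr a))).
  apply: continuous_measurable_fun => y.
  apply: (@continuous_comp _ _ _ (fun y : R => - ln1sqr y) expR).
    by apply: (@continuousN _ _ _ (@ln1sqr R)); exact: continuous_ln1sqr.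
  exact: continuous_expR.
have I0 : (0 <= \int[lebesgue_rV d]_y (expR (- weight y))%:E :> \bar R)%E.
  by apply: integral_ge0 => y _; rewrite lee_fin expR_ge0.
rewrite (@ge0_integralZr _ _ R lebesgue_measure setT measurableT _ mln1sqr)//.
have J0 : (0 <= \int[lebesgue_measure]_a (expR (- ln1sqr (a : R)))%:E)%E.
  by apply: integral_ge0 => y _; rewrite lee_fin expR_ge0.
apply: lte_mul_pinfty => //.
by rewrite ge0_fin_numE//; exact: integral_expRN_ln1sqr_lty.
Qed.

End gibbs.

(** * Green's formula for the adjoint operator *)

Section integration_by_parts.
Context {R : realType} {d : nat}.
Implicit Types f : 'rV[R]_d -> R.

(** Regularity along the i-th axis is what the divergence theorem asks of the
    i-th component of a vector field. *)
Record pure_C1 (i : 'I_d) f : Prop := {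
  C1_continuous : continuous f ;
  C1_derivable : forall x, derivable f x (delta_mx ord0 i) ;
  C1_partial : continuous (partial i f) }.

(** The Laplacian and the divergence contain no mixed derivatives. *)
Record pure_C2 f : Prop := {
  C2_C1 : forall i, pure_C1 i f ;
  C2_continuous : continuous f ;
  C2_partial : forall i, pure_C1 i (partial i f) }.

Variables (B : R) (eta z : 'rV[R]_d -> R) (b : 'rV[R]_d -> 'rV[R]_d).
Hypothesis eta_support : forall x, B < `|x| -> eta x = 0.
Hypothesis Ceta : pure_C2 eta.
Hypothesis Cz : pure_C2 z.
Hypothesis Cb : forall i, pure_C1 i (fun x => b x ord0 i).

Let is_derive_C1 i f x : pure_C1 i f ->
  is_derive x (delta_mx ord0 i) f (partial i f x).
Proof. by move=> Cf; apply: derivableP; exact: C1_derivable Cf x. Qed.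

Let dzb i x := z x * partial i (fun x => b x ord0 i) x + b x ord0 i * partial i z x.

Let is_derive_zb i x :
  is_derive x (delta_mx ord0 i) (fun x => (z x *: b x) ord0 i) (dzb i x).
Proof.
have := is_deriveM (is_derive_C1 x (C2_C1 Cz i)) (is_derive_C1 x (Cb i)).
by congr is_derive; apply/funext => y; rewrite !mxE.
Qed.

(** The vector field whose divergence is the difference between the two
    integrands of Green's formula. *)
Let flux i x :=
  eta x * partial i z x - z x * partial i eta x + eta x * (z x *: b x) ord0 i.

Let dflux i x := eta x * (partial i (partial i z) x + dzb i x) -
  z x * (partial i (partial i eta) x - b x ord0 i * partial i eta x).

Let is_derive_flux i x : is_derive x (delta_mx ord0 i) (flux i) (dflux i x).
Proof.
have e1 := is_derive_C1 x (C2_C1 Ceta i).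
have h1 := is_deriveM e1 (is_derive_C1 x (C2_partial Cz i)).
have h2 := is_deriveM (is_derive_C1 x (C2_C1 Cz i)) (is_derive_C1 x (C2_partial Ceta i)).
have h3 := is_deriveM e1 (is_derive_zb i x).
have := is_deriveD (is_deriveB h1 h2) h3.
by congr is_derive; rewrite /dflux /GRing.scale/= !mxE; ring.
Qed.

Let continuous_dzb i : continuous (dzb i).
Proof.
move=> x; apply: continuous_add; apply: continuous_mul.
- exact: C2_continuous Cz x.
- exact: C1_partial (Cb i) x.
- exact: C1_continuous (Cb i) x.
- exact: C1_partial (C2_C1 Cz i) x.
Qed.

Let f1 x := eta x * (laplacian z x + divergence (fun y => z y *: b y) x).
Let f2 x := z x * (laplacian eta x - \sum_i b x ord0 i * partial i eta x).

Let continuous_f1 : continuous f1.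
Proof.
move=> x; apply: continuous_mul; first exact: C2_continuous Ceta x.
apply: continuous_add.
  by apply: continuous_sum => i; exact: C1_partial (C2_partial Cz i) x.
apply: continuous_sum => i.
have -> : partial i (fun y => (z y *: b y) ord0 i) = dzb i; last exact: (@continuous_dzb i x).
by apply/funext => y; rewrite /partial; have /@derive_val -> := is_derive_zb i y.
Qed.

Lemma continuous_adjoint :
  continuous (fun x => z x * (laplacian eta x - \sum_i b x ord0 i * partial i eta x)).
Proof.
move=> x; apply: continuous_mul; first exact: C2_continuous Cz x.
apply: continuous_sub; apply: continuous_sum => i.
  exact: C1_partial (C2_partial Ceta i) x.
apply: continuous_mul; first exact: C1_continuous (Cb i) x.
exact: C1_partial (C2_C1 Ceta i) x.
Qed.

Let green_divergence x : f1 x - f2 x = \sum_i partial i (flux i) x.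
Proof.
rewrite /f1 /f2 /laplacian /divergence -big_split/= -sumrB !mulr_sumr -sumrB.
apply: eq_bigr => i _.
rewrite [in RHS]/partial; have /@derive_val -> := is_derive_flux i x.
by rewrite /dflux; have /@derive_val <- := is_derive_zb i x.
Qed.

(** Green's formula: eta (Lap z + div (z b)) - z (Lap eta - b . grad eta) is
    the divergence of eta grad z - z grad eta + eta z b, which has compact
    support. *)
Lemma integral_adjoint :
  ((\int[lebesgue_rV d]_x (eta x *
      (laplacian z x + divergence (fun y => z y *: b y) x))%:E) =
   \int[lebesgue_rV d]_x (z x *
      (laplacian eta x - \sum_i b x ord0 i * partial i eta x))%:E)%E.
Proof.
have s1 x : B < `|x| -> f1 x = 0.
  by move=> h; rewrite /f1 eta_support// mul0r.
have s2 x : B < `|x| -> f2 x = 0.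
  have se i := partial_support i eta_support.
  move=> h; rewrite /f2 /laplacian !big1 ?subrr ?mulr0// => i _.
    by rewrite se// mulr0.
  exact: (partial_support i (@se i)).
have i1 := cball_support_integrable continuous_f1 s1.
have i2 := cball_support_integrable continuous_adjoint s2.
rewrite -[LHS](@subeK _ _ _ (integrable_fin_num measurableT i2))// -[RHS]add0e.
congr (_ + _)%E.
rewrite -integralB// (eq_integral (fun x => \sum_i (partial i (flux i) x)%:E)%E); last first.
  by move=> x _; rewrite sumEFin -green_divergence EFinB.
have cG i : continuous (partial i (flux i)).
  rewrite (_ : partial i (flux i) = dflux i); last first.
    by apply/funext => y; rewrite /partial; have /@derive_val -> := is_derive_flux i y.
  move=> x; apply: continuous_sub; apply: continuous_mul.
  - exact: C2_continuous Ceta x.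
  - apply: continuous_add; last exact: (@continuous_dzb i x).
    exact: C1_partial (C2_partial Cz i) x.
  - exact: C2_continuous Cz x.
  - apply: continuous_sub; first exact: C1_partial (C2_partial Ceta i) x.
    apply: continuous_mul; first exact: C1_continuous (Cb i) x.
    exact: C1_partial (C2_C1 Ceta i) x.
have sG i x : B < `|x| -> flux i x = 0.
  move=> h; rewrite /flux eta_support// (partial_support i eta_support)//.
  by rewrite !mul0r mulr0 subrr addr0.
rewrite integral_sum//; last first.
  by move=> i; exact: (cball_support_integrable (@cG i) (partial_support i (@sG i))).
rewrite big1// => i _; apply: (integral_partial _ (@cG i) (@sG i)) => x.
by case: (is_derive_flux i x).
Qed.

End integration_by_parts.

(** * The fundamental theorem of calculus under the integral *)

Section time.
Context {R : realType} {d : nat}.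
Variables (B s r : R) (eta : 'rV[R]_d -> R) (f Z : 'rV[R]_d * R -> R).
Hypothesis sr : s < r.
Hypothesis ceta : continuous eta.
Hypothesis seta : forall x, B < `|x| -> eta x = 0.
Hypothesis cf : continuous f.
Hypothesis cZ : continuous Z.
Hypothesis fZ : forall x t, s < t < r -> is_derive t 1 (fun t => f (x, t)) (Z (x, t)).

Let W (z : 'rV[R]_d * R) := eta z.1 * Z z.
Let I : set R := `[s, r]%classic.
(** Truncation in time makes the integrand integrable over the whole product
    space, as Fubini's theorem requires. *)
Let W1 (z : 'rV[R]_d * measurableTypeR R) : R := W z * \1_I z.2.

Let cW : continuous W.
Proof.
move=> z; apply: continuous_mul; last exact: cZ.
by apply: (@continuous_comp _ _ _ fst eta); [exact: cvg_fst|exact: ceta].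
Qed.

Let iW : (lebesgue_rV d \x lebesgue_measure)%E.-integrable setT (EFin \o W1).
Proof.
pose K := [set x : 'rV[R]_d | `|x| <= B].
have [M [_ MB]] : bounded_set (W @` (K `*` I)).
  apply: compact_bounded; apply: continuous_compact.
    exact: continuous_subspaceT.
  by apply: compact_setX; [exact: compact_rV_cball|exact: segment_compact].
have mK : measurable K by exact: measurable_rV_cball.
apply: (@bounded_support_integrable _ _ R (lebesgue_rV d \x lebesgue_measure)%E
  (K `*` (I : set (measurableTypeR R))) W1 (M + 1)).
- by apply: measurableX => //; exact: measurable_itv.
- have mI : measurable (I : set (measurableTypeR R)) by exact: measurable_itv.
  have := product_measure1E (lebesgue_rV d) (@lebesgue_measure R) mK mI.
  move=> /= ->; rewrite lte_mul_pinfty//.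
    by rewrite ge0_fin_numE//; exact: lebesgue_rV_cball_lty.
  by rewrite /= lebesgue_measure_itv/=; case: ifPn => // _; rewrite -EFinB ltry.
- apply: (@measurable_funM _ _ _ _ W (fun z => \1_I z.2)).
    exact: continuous_measurable_rVX.
  have mI : measurable_fun [set: measurableTypeR R] (\1_I : R -> R).
    exact: measurable_indic (measurable_itv _).
  exact: (measurableT_comp mI measurable_snd).
- move=> [x t] [/= Kx It]; rewrite /W1 indicE mem_set// mulr1.
  by apply: (MB (M + 1)); [rewrite ltrDl|exists (x, t)].
- move=> [x t] /= /not_andP[/negP|It]; rewrite /W1 /W/=.
    by rewrite -ltNge => /seta ->; rewrite !mul0r.
  by rewrite indicE memNset// mulr0.
Qed.

Let W1E t : (\int[lebesgue_rV d]_x (W1 (x, t))%:E)%E =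
  ((fun t => \int[lebesgue_rV d]_x (W (x, t))%:E)%E \_ I) t.
Proof.
rewrite patchE; case: ifPn => tI.
  by apply: eq_integral => x _; rewrite /W1 indicE tI mulr1.
by apply: integral0_eq => x _; rewrite /W1 indicE (negbTE tI) mulr0.
Qed.

Lemma measurable_time_derivative :
  measurable_fun (`[s, r]%classic : set (measurableTypeR R))
    (fun t => \int[lebesgue_rV d]_x (eta x * Z (x, t))%:E)%E.
Proof.
apply/measurable_restrictT; first exact: measurable_itv.
have := measurable_fubini_G iW; congr measurable_fun.
by apply/funext => t; rewrite -W1E.
Qed.

(** For each x this is the fundamental theorem of calculus in time; the order
    of integration is then exchanged by Fubini's theorem. *)
Lemma integral_time_derivative :
  (\int[lebesgue_rV d]_x (eta x * f (x, r))%:E -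
   \int[lebesgue_rV d]_x (eta x * f (x, s))%:E =
   \int[lebesgue_measure]_(t in `[s, r])
     \int[lebesgue_rV d]_x (eta x * Z (x, t))%:E)%E.
Proof.
have cft t : continuous (fun x => f (x, t)).
  move=> x; apply: (@continuous_comp _ _ _ (fun x => (x, t)) f); last exact: cf.
  by apply: continuous_pair; [exact: cvg_id|exact: cst_continuous].
have cfx x : continuous (fun t => f (x, t)).
  move=> t; apply: (@continuous_comp _ _ _ (fun t => (x, t)) f); last exact: cf.
  by apply: continuous_pair; [exact: cst_continuous|exact: cvg_id].
have cWx x : continuous (fun t => W (x, t)).
  move=> t; apply: (@continuous_comp _ _ _ (fun t => (x, t)) W); last exact: cW.
  by apply: continuous_pair; [exact: cst_continuous|exact: cvg_id].
have ie t : (lebesgue_rV d).-integrable setT (EFin \o (fun x => eta x * f (x, t))).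
  apply: (@cball_support_integrable _ _ B).
    by move=> x; apply: continuous_mul; [exact: ceta|exact: cft].
  by move=> x /seta ->; rewrite mul0r.
rewrite -integralB//=; [|exact: ie|exact: ie].
transitivity (\int[lebesgue_rV d]_x \int[lebesgue_measure]_t (W1 (x, t))%:E)%E.
  apply: eq_integral => x _ /=.
  transitivity (\int[lebesgue_measure]_(t in `[s, r]) (W (x, t))%:E)%E.
    rewrite (@continuous_FTC2 _ _ (fun t => eta x * f (x, t)))//.
    - exact: continuous_subspaceT.
    - split.
      + move=> t; rewrite in_itv/= => str.
        by apply: derivableM => //; have [] := fZ x str.
      + apply: cvg_at_right_filter; apply: continuous_mul; last exact: cfx.
        exact: cst_continuous.
      + apply: cvg_at_left_filter; apply: continuous_mul; last exact: cfx.
        exact: cst_continuous.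
    - move=> t; rewrite in_itv/= => str; rewrite derive1E.
      have fxt := fZ x str.
      have := @is_deriveZ _ _ _ _ (eta x) _ _ _ fxt.
      by move=> /@derive_val.
  rewrite integral_mkcond; apply: eq_integral => t _.
  by rewrite patchE /W1 indicE; case: ifPn => _; rewrite ?mulr1 ?mulr0.
rewrite (integral12_prod_meas1 iW) -(integral21_prod_meas1 iW).
by rewrite [RHS]integral_mkcond; apply: eq_integral => t _; exact: W1E.
Qed.

End time.

(** * Functions that are smooth on a time interval *)

Section within.

Lemma continuous_within_comp (X Y Z : topologicalType) (A : set Y) (g : Y -> Z)
    (phi : X -> Y) :
  {within A, continuous g} -> (forall x, A (phi x)) -> continuous phi ->
  continuous (g \o phi).
Proof.
move=> /subspace_continuousP cg Aphi cphi x P /= /(cg _ (Aphi x)) /=.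
rewrite /nbhs/= /within/= => /(cphi x) h.
rewrite /nbhs/= in h *; apply: filterS h => y /=; exact.
Qed.

Context {R : realType} {d : nat}.
Implicit Types (f : 'rV[R]_d -> R -> R) (I : set R).

(** Freezing the time outside of [s, r] turns a function that is continuous on
    a strip R^d x I into one that is continuous, hence measurable, on R^d x R.
    *)
Definition clamp (s r t : R) := Num.min (Num.max t s) r.

Lemma clamp_itv s r t : s <= r -> s <= clamp s r t <= r.
Proof. by move=> sr; rewrite /clamp le_min ge_min le_max lexx sr orbT/= lexx orbT. Qed.

Lemma clamp_id s r t : s <= t <= r -> clamp s r t = t.
Proof. by move=> /andP[st tr]; rewrite /clamp max_l// min_l. Qed.

Lemma continuous_clamp s r : continuous (clamp s r).
Proof.
move=> t; apply: (@continuous_min _ _ (fun t => Num.max t s) (cst r)).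
  by apply: (@continuous_max _ _ id (cst s)); [exact: cvg_id|exact: cst_continuous].
exact: cst_continuous.
Qed.

Lemma continuous_clamp_time I f s r : s <= r -> `[s, r] `<=` I ->
  {within [set z : 'rV[R]_d * R | I z.2], continuous (fun z => f z.1 z.2)} ->
  continuous (fun z : 'rV[R]_d * R => f z.1 (clamp s r z.2)).
Proof.
move=> sr srI cf.
apply: (@continuous_within_comp _ _ _ _ _
  (fun z : 'rV[R]_d * R => (z.1, clamp s r z.2)) cf).
  by move=> z /=; apply: srI; rewrite /= in_itv/= clamp_itv.
move=> z; apply: continuous_pair; first exact: cvg_fst.
by apply: (@continuous_comp _ _ _ snd (clamp s r)); [exact: cvg_snd|exact: continuous_clamp].
Qed.

Lemma continuous_fixed_time I f t : I t ->
  {within [set z : 'rV[R]_d * R | I z.2], continuous (fun z => f z.1 z.2)} ->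
  continuous (f ^~ t).
Proof.
move=> It cf.
apply: (@continuous_within_comp _ _ _ _ _ (fun x : 'rV[R]_d => (x, t)) cf) => //.
by move=> x; apply: continuous_pair; [exact: cvg_id|exact: cst_continuous].
Qed.

(** At an interior time all small increments stay in I, so that the relative
    derivative is the two-sided one. *)
Lemma is_derive_dt_in I f x t : nbhs t I ->
  cvg (tquot f x t s @[s --> within I t^']) ->
  is_derive t 1 (f x) (dt_in I f x t).
Proof.
move=> tI cvgt; rewrite /dt_in; set l := lim _.
have cl : h^-1 *: ((f x \o shift t) (h *: 1) - f x t) @[h --> 0^'] --> l.
  apply/(@cvgrPdist_lt _ _ _ (0^')) => e e0.
  move/(@cvgrPdist_lt _ _ _ (within I t^')) : cvgt => /(_ _ e0) h.
  have : \forall s \near t^', `|l - tquot f x t s| < e.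
    have h' : \forall s \near t^', I s by exact: cvg_within tI.
    have h2 : \forall s \near t^', I s -> `|l - tquot f x t s| < e := h.
    by apply: (filterS2 _ _ h2 h') => s /= hs Is; exact: hs.
  move=> /nbhs_ballP[r /= r0 rP]; apply/nbhs_ballP; exists r => //= k.
  rewrite /ball/= sub0r normrN => kr k0.
  have := rP (k + t); rewrite /ball/= opprD addrCA subrr addr0 normrN => /(_ kr).
  have kt : k + t != t by rewrite -subr_eq0 addrK.
  by move=> /(_ kt); rewrite /tquot addrK [k *: 1]mulr1 mulrC.
by split; [apply/cvg_ex; exists l|exact/cvg_lim].
Qed.

End within.

(** * Regularity of the drift *)

Section drift.
Context {R : realType} {d : nat}.
Variables (G : 'rV[R]_d * 'rV[R]_d -> R) (v : 'rV[R]_d -> R).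
Hypothesis dG : forall z, differentiable G z.
Hypothesis cG : forall w, continuous ('D_w G).
Hypothesis dv : forall j x, differentiable (partial j v) x.
Hypothesis cv : forall i j, continuous (partial i (partial j v)).

Let phi (x : 'rV[R]_d) := (x, grad v x).

Let gradE : grad v = fun x => \sum_j (partial j v x *: delta_mx ord0 j : 'rV[R]_d).
Proof.
apply/funext => x; rewrite [LHS]row_sum_delta; apply: eq_bigr => j _.
by rewrite mxE.
Qed.

Let diff_grad x : differentiable (grad v) x.
Proof.
rewrite gradE.
have -> : (fun x => \sum_j (partial j v x *: delta_mx ord0 j : 'rV[R]_d)) =
   \sum_(j < d) (fun x => partial j v x *: delta_mx ord0 j : 'rV[R]_d).
  by apply/funext => y; rewrite fct_sumE.
by apply: differentiable_sum => j; apply: differentiableZl.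
Qed.

Let diff_phi x : differentiable phi x.
Proof. exact: differentiable_pair. Qed.

Lemma differentiable_drift x : differentiable (G \o phi) x.
Proof. exact: differentiable_comp. Qed.

Let D_grad i x : 'D_(delta_mx ord0 i) (grad v) x = \row_j partial i (partial j v) x.
Proof.
rewrite derive_mx; last exact: diff_derivable.
apply/matrixP => k j; rewrite [LHS]mxE [RHS]mxE.
have -> : (fun t => grad v t k j) = partial j v by apply/funext => y; rewrite mxE.
by [].
Qed.

(** The chain rule along x |-> (x, Dv (x)). The coordinates of the drift D_pH
    (x, Du) are of this form, with G a partial derivative of H in its second
    variable. *)
Lemma partial_drift i x : partial i (G \o phi) x =
  'D_((delta_mx ord0 i, 0) : 'rV[R]_d * 'rV[R]_d) G (phi x) +
  \sum_j partial i (partial j v) x * 'D_((0, delta_mx ord0 j) : 'rV[R]_d * 'rV[R]_d) G (phi x).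
Proof.
rewrite /partial deriveE; last exact: differentiable_drift.
rewrite diff_comp//=.
have -> : 'd phi x (delta_mx ord0 i) = (delta_mx ord0 i, \row_j partial i (partial j v) x).
  rewrite diff_pair//=; congr pair; last by rewrite -deriveE// D_grad.
  by rewrite -deriveE// derive_id.
have -> : ((delta_mx ord0 i, \row_j partial i (partial j v) x) : 'rV[R]_d * 'rV[R]_d) =
  (delta_mx ord0 i, 0) + \sum_j partial i (partial j v) x *: (0, delta_mx ord0 j).
  transitivity ((delta_mx ord0 i, 0) +
      (0, \sum_j partial i (partial j v) x *: delta_mx ord0 j) :
      'rV[R]_d * 'rV[R]_d).
    rewrite [X in (_, X)]row_sum_delta; congr (_, _); rewrite ?addr0// add0r.
    by apply: eq_bigr => j _; rewrite mxE.
  congr (_ + _).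
  elim/big_rec2 : _ => [//|j y1 y2 _ <-].
  set k := partial i (partial j v) x.
  transitivity ((k *: 0 + 0, k *: delta_mx ord0 j + y2) : 'rV[R]_d * 'rV[R]_d) => //.
  by rewrite scaler0 addr0.
rewrite linearD linear_sum/= -deriveE//; congr (_ + _); apply: eq_bigr => j _.
by rewrite linearZ/= -deriveE.
Qed.

Lemma continuous_drift : continuous (G \o phi).
Proof. by move=> x; exact: differentiable_continuous (differentiable_drift x). Qed.

Lemma continuous_partial_drift i : continuous (partial i (G \o phi)).
Proof.
have cphi : continuous phi.
  by move=> x; exact: differentiable_continuous (diff_phi x).
rewrite (_ : partial i _ = fun x =>
    'D_((delta_mx ord0 i, 0) : 'rV[R]_d * 'rV[R]_d) G (phi x) +
    \sum_j partial i (partial j v) x *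
      'D_((0, delta_mx ord0 j) : 'rV[R]_d * 'rV[R]_d) G (phi x)); last first.
  by apply/funext => x; exact: partial_drift.
have cDG w : continuous (fun x => 'D_w G (phi x)).
  by move=> x; apply: (@continuous_comp _ _ _ phi ('D_w G)); [exact: cphi|exact: cG].
move=> x; apply: continuous_add; first exact: cDG.
apply: (@continuous_sum _ _ _ (fun j x => partial i (partial j v) x *
  'D_((0, delta_mx ord0 j) : 'rV[R]_d * 'rV[R]_d) G (phi x))) => j.
apply: continuous_mul; first exact: (@cv i j x).
exact: cDG.
Qed.

End drift.

(** * Evolution of the truncated weight *)

Section cutoff_C2.
Context {R : realType} {d : nat} (rho : R).
Let etaN (x : 'rV[R]_d) := - cutoff rho x.

Lemma partial_cutoffN i : partial i etaN = fun x => - dcutoff rho i x.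
Proof.
apply/funext => x; rewrite /partial.
by have /@derive_val := is_deriveN (is_derive_cutoff rho i x).
Qed.

Lemma partial2_cutoffN i : partial i (partial i etaN) = fun x => - ddcutoff rho i x.
Proof.
rewrite partial_cutoffN; apply/funext => x; rewrite /partial.
by have /@derive_val := is_deriveN (is_derive_dcutoff rho i x).
Qed.

(** Testing with the opposite of the cutoff turns the lower bounds on its
    evolution into upper bounds, which is the form of [le_integral_ge0]. *)
Lemma cutoffN_C2 : pure_C2 etaN.
Proof.
have c0 : continuous etaN.
  by move=> x; apply: (@continuousN _ _ _ (cutoff rho)); exact: continuous_cutoff.
have c1 i : continuous (fun x : 'rV[R]_d => - dcutoff rho i x).
  by move=> x; apply: (@continuousN _ _ _ (dcutoff rho i)); exact: continuous_dcutoff.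
split=> // i; split=> //.
- by move=> x; have [] := is_deriveN (is_derive_cutoff rho i x).
- by rewrite partial_cutoffN.
- by rewrite partial_cutoffN.
- by rewrite partial_cutoffN => x; have [] := is_deriveN (is_derive_dcutoff rho i x).
- rewrite partial2_cutoffN => x.
  by apply: (@continuousN _ _ _ (ddcutoff rho i)); exact: continuous_ddcutoff.
Qed.

End cutoff_C2.

Section evolution.
Context {R : realType} {d : nat}.
Variables (H : 'rV[R]_d -> 'rV[R]_d -> R) (T tau : R).
Variables (u zeta : 'rV[R]_d -> R -> R).
Hypothesis tau0 : 0 <= tau.
Hypothesis Hsmooth : smooth (fun z : 'rV[R]_d * 'rV[R]_d => H z.1 z.2).
Hypothesis usmooth : smooth_in `[0, T] u.
Hypothesis zsmooth : smooth_in `]tau, T] zeta.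
Hypothesis zeta_ge0 : forall x t, tau <= t <= T -> 0 <= zeta x t.
Hypothesis zeta_eq : forall x t, tau < t <= T ->
    dt_in `]tau, T] zeta x t -
      divergence (fun y => zeta y t *: DpH_Du H u y t) x =
    laplacian (zeta ^~ t) x.

Let G i := 'D_((0, delta_mx ord0 i) : 'rV[R]_d * 'rV[R]_d)
  (fun z : 'rV[R]_d * 'rV[R]_d => H z.1 z.2).

Lemma DpH_DuE i t : (fun x => DpH_Du H u x t ord0 i) =
  G i \o (fun x => (x, grad (u ^~ t) x)).
Proof.
apply/funext => x; rewrite mxE /partial /G /=.
apply: (@derive_comp_affine _ _ _ _ (fun z : 'rV[R]_d * 'rV[R]_d => H z.1 z.2) (pair x)).
move=> h; transitivity ((h *: 0 + x, h *: delta_mx ord0 i + grad (u ^~ t) x)) => //.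
by rewrite scaler0 add0r.
Qed.

Let dG i z : differentiable (G i) z.
Proof. by have [_ /(_ (0, delta_mx ord0 i))[]] := Hsmooth 2. Qed.

Let cDG i w : continuous ('D_w (G i)).
Proof. by have [_ /(_ (0, delta_mx ord0 i))[_]] := Hsmooth 2; exact. Qed.

Let cG i : continuous (G i).
Proof. by move=> z; exact: differentiable_continuous (dG i z). Qed.

Let uI t : tau < t <= T -> `[0, T]%classic t.
Proof. by move=> /andP[tt tT]; rewrite /= in_itv/= tT (le_trans tau0 (ltW tt)). Qed.

Let zI t : tau < t <= T -> `]tau, T]%classic t.
Proof. by move=> h; rewrite /= in_itv. Qed.

Lemma continuous_DpH_Du_clamp i s r : tau < s <= r -> r <= T ->
  continuous (fun z : 'rV[R]_d * R => DpH_Du H u z.1 (clamp s r z.2) ord0 i).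
Proof.
move=> /andP[ts sr] rT.
have -> : (fun z : 'rV[R]_d * R => DpH_Du H u z.1 (clamp s r z.2) ord0 i) =
  G i \o (fun z => (z.1, grad (u ^~ (clamp s r z.2)) z.1)).
  by apply/funext => z; have /(congr1 (fun f => f z.1)) := DpH_DuE i (clamp s r z.2).
move=> z.
apply: (@continuous_comp _ _ _
  (fun z => (z.1, grad (u ^~ (clamp s r z.2)) z.1)) (G i)); last exact: cG.
apply: continuous_pair; first exact: cvg_fst.
apply: continuous_rV => j.
have -> : (fun y : 'rV[R]_d * R => grad (u^~ (clamp s r y.2)) y.1 ord0 j) =
  (fun z => partial j (u ^~ (clamp s r z.2)) z.1) by apply/funext => y; rewrite mxE.
have [_ /(_ j)+ _ _] := usmooth 1.
move=> h; apply: (@continuous_clamp_time _ _ `[0, T]%classic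
  (fun x t => partial j (u ^~ t) x) s r sr) => // t /=; rewrite !in_itv/=.
by move=> /andP[st tr]; rewrite (le_trans _ st)/= ?(le_trans tr)// (le_trans tau0)// ltW.
Qed.

Definition drift_energy t :=
  (\int[lebesgue_rV d]_x (enorm (DpH_Du H u x t) ^+ 2 * zeta x t)%:E)%E.

Let energy_clamp s r (z : 'rV[R]_d * R) :=
  enorm (DpH_Du H u z.1 (clamp s r z.2)) ^+ 2 * zeta z.1 (clamp s r z.2).

Lemma enorm_sqr (v : 'rV[R]_d) : enorm v ^+ 2 = \sum_i v ord0 i ^+ 2.
Proof. by rewrite sqr_sqrtr// sumr_ge0// => i _; exact: sqr_ge0. Qed.

Let continuous_zeta_clamp s r : tau < s <= r -> r <= T ->
  continuous (fun z : 'rV[R]_d * R => zeta z.1 (clamp s r z.2)).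
Proof.
move=> /andP[ts sr] rT; apply: (@continuous_clamp_time _ _ `]tau, T]%classic zeta) => //.
  move=> t /=; rewrite !in_itv/= => /andP[st tr].
  by rewrite (lt_le_trans ts st) (le_trans tr).
exact: zsmooth 0.
Qed.

Let continuous_energy_clamp s r : tau < s <= r -> r <= T ->
  continuous (energy_clamp s r).
Proof.
move=> tsr rT; rewrite /energy_clamp => z; apply: continuous_mul; last exact: continuous_zeta_clamp.
rewrite (_ : (fun y : 'rV[R]_d * R => _) =
  fun z => \sum_i DpH_Du H u z.1 (clamp s r z.2) ord0 i ^+ 2); last first.
  by apply/funext => y; exact: enorm_sqr.
apply: continuous_sum => i.
have c := @continuous_DpH_Du_clamp i s r tsr rT.
by apply: (@continuous_comp _ _ _ _ (fun a : R => a ^+ 2) z (c z)); exact: exprn_continuous.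
Qed.

(** On [s, r] the energy is the integral in x of a nonnegative continuous
    function of (x, t), hence measurable by Tonelli's theorem. *)
Lemma measurable_drift_energy s r : tau < s <= r -> r <= T ->
  measurable_fun (`[s, r]%classic : set (measurableTypeR R)) drift_energy.
Proof.
move=> tsr rT.
have mE : measurable_fun [set: 'rV[R]_d * measurableTypeR R] (EFin \o energy_clamp s r).
  apply/measurable_EFinP; apply: continuous_measurable_rVX.
  exact: continuous_energy_clamp.
have E0 z : (0 <= (EFin \o energy_clamp s r) z)%E.
  rewrite lee_fin mulr_ge0 ?sqr_ge0// zeta_ge0//.
  move: tsr => /andP[ts sr]; have /andP[h1 h2] := clamp_itv z.2 sr.
  by rewrite (le_trans (ltW ts) h1) (le_trans h2).
have := measurable_fun_fubini_tonelli_G (m1 := lebesgue_rV d) _ mE E0.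
move=> /(measurable_funS measurableT (@subsetT _ `[s, r]%classic)).
apply: eq_measurable_fun => t; rewrite inE/= in_itv/= => str.
by apply: eq_integral => x _; rewrite /= /energy_clamp/= clamp_id.
Qed.

Lemma DpH_Du_C1 i t : tau < t <= T ->
  pure_C1 i (fun x => DpH_Du H u x t ord0 i).
Proof.
move=> /uI It; rewrite DpH_DuE.
have du j x : differentiable (partial j (u ^~ t)) x.
  by have [_ /(_ j)[/(_ x t It)]] := usmooth 2.
have cu k j : continuous (partial k (partial j (u ^~ t))).
  have [_ /(_ j)[_ /(_ k) + _ _] _ _] := usmooth 2.
  exact: (@continuous_fixed_time _ _ _ (fun x t => partial k (partial j (u ^~ t)) x)).
split.
- exact: continuous_drift.
- by move=> x; apply: diff_derivable; exact: differentiable_drift.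
- exact: continuous_partial_drift.
Qed.

Lemma zeta_C2 t : tau < t <= T -> pure_C2 (zeta ^~ t).
Proof.
move=> /zI It.
have c0 : continuous (zeta ^~ t) by exact: continuous_fixed_time It (zsmooth 0).
have c1 i : continuous (partial i (zeta ^~ t)).
  have [_ /(_ i) + _ _] := zsmooth 1.
  exact: (@continuous_fixed_time _ _ _ (fun x t => partial i (zeta ^~ t) x)).
have d1 x : differentiable (zeta ^~ t) x.
  by have [/(_ x t It)] := zsmooth 1.
have d2 i x : differentiable (partial i (zeta ^~ t)) x.
  by have [_ /(_ i)[/(_ x t It)]] := zsmooth 2.
have c2 i : continuous (partial i (partial i (zeta ^~ t))).
  have [_ /(_ i)[_ /(_ i) + _ _] _ _] := zsmooth 2.
  exact: (@continuous_fixed_time _ _ _ (fun x t => partial i (partial i (zeta ^~ t)) x)).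
by split=> // i; split=> // x; exact: diff_derivable.
Qed.

Lemma zeta_dtE t x : tau < t <= T -> dt_in `]tau, T] zeta x t =
  laplacian (zeta ^~ t) x + divergence (fun y => zeta y t *: DpH_Du H u y t) x.
Proof. by move=> tI; rewrite -zeta_eq// subrK. Qed.

(** For each coordinate, 12 bounds the second derivative and 3 |v_i| <= 3 (1 +
    v_i^2) the first-order term, whence 15 = 12 + 3. *)
Lemma drift_le (rho : R) (v x : 'rV[R]_d) : 1 <= rho ->
  - \sum_i ddcutoff rho i x + \sum_i v ord0 i * dcutoff rho i x <=
  (15 * d)%:R + 3 * enorm v ^+ 2.
Proof.
move=> rho1; have rho0 : 0 < rho by lra.
rewrite enorm_sqr mulr_sumr -sumrN -big_split/=.
have -> : (15 * d)%:R = \sum_(i < d) 15%:R :> R.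
  by rewrite sumr_const card_ord -mulrnA.
rewrite -big_split/= ler_sum// => i _.
have /ler_normlP[h1 _] := abs_ddcutoff_le i x rho1.
have h2 : v ord0 i * dcutoff rho i x <= `|v ord0 i| * 3.
  rewrite (le_trans (ler_norm _))// normrM ler_wpM2l//.
  exact: abs_dcutoff_le.
have h3 : `|v ord0 i| <= 1 + v ord0 i ^+ 2.
  rewrite -[X in _ + X]real_normK ?num_real//.
  by have := sqr_ge0 (`|v ord0 i| - 1); rewrite sqrrB; have := normr_ge0 (v ord0 i); lra.
lra.
Qed.

(** By Green's formula all the derivatives in space fall on the cutoff, where
    [drift_le] bounds them uniformly in rho. *)
Lemma integral_dt_cutoff_le rho t (M : R) : 1 <= rho -> tau < t <= T ->
  (\int[lebesgue_rV d]_x (zeta x t)%:E = M%:E)%E ->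
  (\int[lebesgue_rV d]_x (- cutoff rho x * dt_in `]tau, T] zeta x t)%:E <=
   ((15 * d)%:R * M)%:E + 3%:E * drift_energy t)%E.
Proof.
move=> rho1 tI zM; have rho0 : 0 < rho by lra.
have z0 x : 0 <= zeta x t.
  by case/andP: tI => h1 h2; rewrite zeta_ge0// (ltW h1).
under eq_integral do rewrite zeta_dtE//.
rewrite (@integral_adjoint _ _ (expR rho) _ (zeta ^~ t) (DpH_Du H u ^~ t)).
- have mz : measurable_fun setT (fun x => (zeta x t)%:E).
    apply/(@measurable_EFinP _ _ _ _ (zeta ^~ t)).
    by apply: continuous_measurable_rV; exact: C2_continuous (zeta_C2 tI).
  have me : measurable_fun setT (fun x => (enorm (DpH_Du H u x t) ^+ 2 * zeta x t)%:E).
    apply/(@measurable_EFinP _ _ _ _ (fun x => enorm (DpH_Du H u x t) ^+ 2 * zeta x t)).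
    apply: continuous_measurable_rV => x.
    apply: continuous_mul; last exact: C2_continuous (zeta_C2 tI) x.
    rewrite (_ : (fun y : 'rV[R]_d => _) =
      fun y => \sum_i DpH_Du H u y t ord0 i ^+ 2); last first.
      by apply/funext => y; exact: enorm_sqr.
    apply: continuous_sum => i.
    apply: (@continuous_comp _ _ _ (fun y => DpH_Du H u y t ord0 i) (fun a : R => a ^+ 2)).
      exact: C1_continuous (DpH_Du_C1 i tI) x.
    exact: exprn_continuous.
  have p1 x : (0 <= ((15 * d)%:R)%:E * (zeta x t)%:E :> \bar R)%E.
    by rewrite -EFinM lee_fin mulr_ge0.
  have p2 x : (0 <= 3%:E * (enorm (DpH_Du H u x t) ^+ 2 * zeta x t)%:E :> \bar R)%E.
    by rewrite -EFinM lee_fin mulr_ge0// mulr_ge0// sqr_ge0.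
  have m1 : measurable_fun setT (fun x => ((15 * d)%:R)%:E * (zeta x t)%:E)%E.
    exact: measurable_funeM.
  have m2 : measurable_fun setT (fun x =>
      3%:E * (enorm (DpH_Du H u x t) ^+ 2 * zeta x t)%:E)%E.
    exact: measurable_funeM.
  have e0 x : (0 <= (enorm (DpH_Du H u x t) ^+ 2 * zeta x t)%:E :> \bar R)%E.
    by rewrite lee_fin mulr_ge0// sqr_ge0.
  have z0E x : (0 <= (zeta x t)%:E :> \bar R)%E by rewrite lee_fin.
  rewrite EFinM -zM /drift_energy -!ge0_integralZl//.
  rewrite -ge0_integralD//.
  apply: le_integral_ge0 => //.
  + apply/(@measurable_EFinP _ _ _ _ (fun x => zeta x t *
      (laplacian (fun x => - cutoff rho x) x -
       \sum_i DpH_Du H u x t ord0 i * partial i (fun x => - cutoff rho x) x))).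
    apply: continuous_measurable_rV.
    apply: (@continuous_adjoint _ _ _ (zeta ^~ t) (DpH_Du H u ^~ t)).
    * exact: cutoffN_C2.
    * exact: zeta_C2.
    * by move=> i; exact: DpH_Du_C1.
  + exact: emeasurable_funD.
  + by move=> x _; exact: adde_ge0.
  + move=> x _; rewrite -!EFinM -EFinD lee_fin mulrCA mulrA -mulrDl mulrC ler_wpM2r//.
    rewrite /laplacian; under eq_bigr do rewrite partial2_cutoffN.
    rewrite sumrN; under [X in _ - X]eq_bigr do rewrite partial_cutoffN mulrN.
    rewrite sumrN opprK.
    by rewrite [X in _ <= _ + X]mulrC drift_le.
- by move=> x h; rewrite cutoff_support ?oppr0// ltW.
- exact: cutoffN_C2.
- exact: zeta_C2.
- by move=> i; exact: DpH_Du_C1.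
Qed.

Lemma measurable_drift_energy_oc r : r <= T ->
  measurable_fun (`]tau, r]%classic : set (measurableTypeR R)) drift_energy.
Proof.
move=> rT.
have -> : `]tau, r]%classic = \bigcup_n `[tau + n.+1%:R^-1, r]%classic :> set R.
  by rewrite itv_open_bnd_bigcup.
apply/measurable_fun_bigcup => n; first exact: measurable_itv.
have [h|h] := leP (tau + n.+1%:R^-1) r.
  by apply: measurable_drift_energy => //; rewrite h ltrDl invr_gt0 ltr0n.
rewrite set_itv_ge; first exact: measurable_fun_set0.
by rewrite bnd_simp -ltNge.
Qed.

(** This is [integral_dt_cutoff_le] integrated over the times in [s, r]. The
    initial time s is larger than tau because zeta is smooth only after tau. *)
Lemma cutoff_evolution rho s r (M : R) : 1 <= rho -> tau < s < r -> r <= T ->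
  (forall t, tau < t <= T -> (\int[lebesgue_rV d]_x (zeta x t)%:E = M%:E)%E) ->
  (\int[lebesgue_rV d]_x (cutoff rho x * zeta x s)%:E -
   \int[lebesgue_rV d]_x (cutoff rho x * zeta x r)%:E <=
   ((15 * d)%:R * M * T)%:E +
     3%:E * \int[lebesgue_measure]_(t in `]tau, r]) drift_energy t)%E.
Proof.
move=> rho1 /andP[ts sr] rT zM; have rho0 : 0 < rho by lra.
have tI t : s <= t <= r -> tau < t <= T.
  by move=> /andP[st tr]; rewrite (lt_le_trans ts st) (le_trans tr rT).
have M0 : 0 <= M.
  have rI : tau < r <= T by rewrite (lt_trans ts sr).
  rewrite -lee_fin -(zM _ rI) integral_ge0// => x _.
  by rewrite lee_fin zeta_ge0// (ltW (lt_trans ts sr)).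
have J0 t : s <= t <= r -> (0 <= drift_energy t)%E.
  move=> /tI/andP[h1 h2]; apply: integral_ge0 => x _.
  by rewrite lee_fin mulr_ge0 ?sqr_ge0// zeta_ge0// (ltW h1).
have supp x : expR rho < `|x| -> - @cutoff R d rho x = 0.
  by move=> h; rewrite cutoff_support ?oppr0// ltW.
have ceta : continuous (fun x : 'rV[R]_d => - cutoff rho x).
  exact: C2_continuous (cutoffN_C2 _).
have srI : `[s, r] `<=` `]tau, T].
  by move=> t /=; rewrite !in_itv/=; exact: tI.
have cf : continuous (fun z : 'rV[R]_d * R => zeta z.1 (clamp s r z.2)).
  by apply: continuous_zeta_clamp => //; rewrite ts ltW.
have cZ : continuous (fun z : 'rV[R]_d * R => dt_in `]tau, T] zeta z.1 (clamp s r z.2)).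
  have [_ _ _ h] := zsmooth 1.
  exact: (continuous_clamp_time (ltW sr) srI h).
have fZ x t : s < t < r -> is_derive t 1 (fun t => zeta x (clamp s r t))
    (dt_in `]tau, T] zeta x (clamp s r t)).
  move=> /andP[st tr]; rewrite clamp_id ?(ltW st) ?(ltW tr)//.
  apply: (@near_eq_is_derive R R R (zeta x)).
    have : \forall t' \near t, t' \in `]s, r[ by apply: near_in_itvoo; rewrite in_itv/= st tr.
    apply: filterS => t'; rewrite in_itv/= => /andP[h1 h2].
    by rewrite clamp_id// (ltW h1) (ltW h2).
  apply: is_derive_dt_in.
    have : \forall t' \near t, t' \in `]s, r[ by apply: near_in_itvoo; rewrite in_itv/= st tr.
    apply: filterS => t'; rewrite in_itv/= => /andP[h1 h2].
    by apply: srI; rewrite /= in_itv/= (ltW h1) (ltW h2).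
  have [_ _ h _] := zsmooth 1; apply: h.
  by apply: srI; rewrite /= in_itv/= (ltW st) (ltW tr).
have iz t : s <= t <= r -> (lebesgue_rV d).-integrable setT
    (EFin \o (fun x => cutoff rho x * zeta x t)).
  move=> /tI It; apply: (@cball_support_integrable _ _ (expR rho)).
    move=> x; apply: continuous_mul; first exact: continuous_cutoff.
    exact: C2_continuous (zeta_C2 It) x.
  by move=> x h; rewrite cutoff_support ?mul0r// ltW.
have iN t : s <= t <= r ->
    (\int[lebesgue_rV d]_x (- cutoff rho x * zeta x (clamp s r t))%:E =
    - \int[lebesgue_rV d]_x (cutoff rho x * zeta x t)%:E)%E.
  move=> It; rewrite clamp_id// -integralN; last exact: integrable_add_def (iz t It).
  by apply: eq_integral => x _; rewrite mulNr EFinN.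
have := integral_time_derivative sr ceta supp cf cZ fZ.
have mA := measurable_time_derivative ceta supp cZ.
rewrite /= !iN ?lexx ?(ltW sr)// oppeK addeC => ->.
have mJ : measurable_fun (`[s, r]%classic : set (measurableTypeR R)) drift_energy.
  by apply: measurable_drift_energy => //; rewrite ts ltW.
have dM0 : 0 <= (15 * d)%:R * M by rewrite mulr_ge0.
apply: (@le_trans _ _ (\int[lebesgue_measure]_(t in `[s, r])
  (((15 * d)%:R * M)%:E + 3%:E * drift_energy t))%E).
  apply: le_integral_ge0 => //.
  - by apply: emeasurable_funD => //; exact: measurable_funeM.
  - move=> t /=; rewrite in_itv/= => /J0 j0.
    by rewrite adde_ge0 ?lee_fin// mule_ge0.
  - move=> t /=; rewrite in_itv/= => str.
    under eq_integral do rewrite clamp_id//.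
    by apply: integral_dt_cutoff_le => //; [exact: tI|exact/zM/tI].
have m3J : measurable_fun (`[s, r]%classic : set (measurableTypeR R))
    (fun t => 3%:E * drift_energy t)%E by exact: measurable_funeM.
have J30 t : `[s, r]%classic t -> (0 <= 3%:E * drift_energy t)%E.
  by rewrite /= in_itv/= => /J0 j0; rewrite mule_ge0.
have JE0 t : `[s, r]%classic t -> (0 <= drift_energy t)%E.
  by rewrite /= in_itv/=; exact: J0.
rewrite ge0_integralD//= integral_cst//= lebesgue_measure_itv/= lte_fin sr -EFinB -EFinM.
apply: leeD.
  by rewrite lee_fin ler_wpM2l//; have := ltW (le_lt_trans tau0 ts); lra.
rewrite ge0_integralZl//; apply: lee_wpmul2l; first by rewrite lee_fin.
apply: ge0_subset_integral => //.
- exact: measurable_drift_energy_oc.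
- move=> t /=; rewrite in_itv/= => /andP[h1 h2]; apply: integral_ge0 => x _.
  by rewrite lee_fin mulr_ge0 ?sqr_ge0// zeta_ge0// (ltW h1) (le_trans h2).
- by move=> t /=; rewrite !in_itv/= => /andP[h1 ->]; rewrite (lt_le_trans ts).
Qed.

End evolution.

(** * Mass, moment and entropy *)

(** The integral of f^p is 1, and f <= 1 + f^p on A. *)
Lemma integral_le_Lnorm d (X : measurableType d) (R : realType)
    (mu : {measure set X -> \bar R}) (A : set X) (f : X -> R) (p : R) :
  measurable A -> measurable_fun setT f -> (forall x, 0 <= f x) ->
  (forall x, ~ A x -> f x = 0) -> 1 <= p ->
  'N[mu]_(p%:E)[EFin \o f]%E = 1%E ->
  (\int[mu]_x (f x)%:E <= mu A + 1)%E.
Proof.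
move=> mA mf f0 fA p1 Nf; have p0 : p != 0 by rewrite lt0r_neq0//; lra.
have : (\int[mu]_x (f x `^ p)%:E = 1)%E.
  have := poweR_Lnorm mu (EFin \o f) p0; rewrite Nf poweR1r => ->.
  by apply: eq_integral => x _; rewrite /= ger0_norm.
have mI : measurable_fun setT (fun x => (\1_A x : R)%:E).
  exact/measurable_EFinP/measurable_indic.
have mp : measurable_fun setT (fun x => (f x `^ p)%:E).
  by apply/measurable_EFinP; apply: (measurableT_comp (measurable_powR p)).
have I0 x : (0 <= (\1_A x : R)%:E)%E by rewrite lee_fin.
have fp0 x : (0 <= (f x `^ p)%:E)%E by rewrite lee_fin powR_ge0.
move=> <-; rewrite -[X in (mu X + _)%E]setIT -integral_indic// -ge0_integralD//.
apply: ge0_le_integral => //.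
- by move=> x _; rewrite lee_fin.
- exact/measurable_EFinP.
- exact: emeasurable_funD.
- move=> x _; rewrite -EFinD lee_fin indicE.
  have [xA|xA] := boolP (x \in A); last first.
    by rewrite [leLHS]fA ?addr_ge0 ?powR_ge0//; move: xA; rewrite notin_setE.
  have [f1|f1] := leP (f x) 1; first by rewrite (le_trans f1)// lerDl powR_ge0.
  apply: (@le_trans _ _ (f x `^ p)); last by rewrite lerDr.
  by rewrite -[leLHS](powRr1 (f0 x)) ler_powR// ltW.
Qed.

(** For s > 0 this is ln y <= y at y = exp (- w) / s. *)
Lemma entropy_ge (R : realType) (s w : R) : 0 <= s ->
  - (s * ln s) <= s * w + expR (- w).
Proof.
rewrite le_eqVlt => /predU1P[<-|s0].
  by rewrite !mul0r oppr0 add0r expR_ge0.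
have y0 : 0 < expR (- w) / s by rewrite divr_gt0// expR_gt0.
have := ltW (ln_sublinear y0).
rewrite ln_div ?posrE ?expR_gt0// expRK ler_pdivlMr//; lra.
Qed.

Section moment.
Context {R : realType} {d : nat}.
Variables (H : 'rV[R]_d -> 'rV[R]_d -> R) (T tau : R).
Variables (u zeta : 'rV[R]_d -> R -> R) (phi : 'rV[R]_d -> R).
Variables (r M W D : R).
Hypothesis tau0 : 0 <= tau.
Hypothesis Hsmooth : smooth (fun z : 'rV[R]_d * 'rV[R]_d => H z.1 z.2).
Hypothesis usmooth : smooth_in `[0, T] u.
Hypothesis zetaP : adjoint_solution H u tau T phi zeta.
Hypothesis phi0 : forall x, 0 <= phi x.
Hypothesis iphi : (lebesgue_rV d).-integrable setT (EFin \o phi).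
Hypothesis phiM : (\int[lebesgue_rV d]_x (phi x)%:E = M%:E)%E.
Hypothesis phiW : forall x, phi x != 0 -> weight x <= W.
Hypothesis taur : tau < r <= T.
Hypothesis energyD :
  (\int[lebesgue_measure]_(t in `]tau, r]) drift_energy H u zeta t = D%:E)%E.

Let zeta_ge0 x : 0 <= zeta x r.
Proof. by case/andP: taur => h1 h2; apply: (adj_ge0 zetaP); rewrite (ltW h1). Qed.

Let zetaM t : tau < t <= T -> (\int[lebesgue_rV d]_x (zeta x t)%:E = M%:E)%E.
Proof. by move=> /andP[h1 h2]; rewrite (adj_mass zetaP) ?(ltW h1)// phiM. Qed.

Let czeta : continuous (zeta ^~ r).
Proof. exact: C2_continuous (zeta_C2 (adj_smooth zetaP) taur). Qed.

Let mzeta : measurable_fun setT (zeta ^~ r).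
Proof. exact: continuous_measurable_rV. Qed.

Let izeta : (lebesgue_rV d).-integrable setT (EFin \o (zeta ^~ r)).
Proof.
apply/integrableP; split; first exact/measurable_EFinP.
under eq_integral do rewrite /= ger0_norm//.
by rewrite zetaM// ltry.
Qed.

Let c : R := (15 * d)%:R * M * T + 3 * D.

Let mcut rho : measurable_fun setT (@cutoff R d rho).
Proof. by apply: continuous_measurable_rV; exact: continuous_cutoff. Qed.

Let icut rho : 0 < rho -> (lebesgue_rV d).-integrable setT
    (EFin \o (fun x => cutoff rho x * zeta x r)).
Proof.
move=> rho0; apply: (@cball_support_integrable _ _ (expR rho)).
  by move=> x; apply: continuous_mul; [exact: continuous_cutoff|exact: czeta].
by move=> x h; rewrite cutoff_support ?mul0r// ltW.
Qed.

Let cut_le rho (x : 'rV[R]_d) : 0 < rho -> cutoff rho x <= rho.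
Proof.
move=> rho0; rewrite -subr_ge0 (le_trans _ (subr_cutoff_ge x rho0))//.
by rewrite le_min weight_ge0 ltW.
Qed.

Let mphi : measurable_fun setT phi.
Proof. by apply/measurable_EFinP; exact: (measurable_int _ iphi). Qed.

Let icutphi rho : 0 < rho -> (lebesgue_rV d).-integrable setT
    (EFin \o (fun x => cutoff rho x * phi x)).
Proof.
move=> rho0; apply: (@le_integrable _ _ _ _ _ _ _ (EFin \o (fun x => rho * phi x))) => //.
- apply/measurable_EFinP/measurable_funM; first exact: mcut.
  exact: mphi.
- move=> x _; rewrite /= lee_fin (normrM (cutoff _ _)) (normrM rho) ler_wpM2r//.
  by rewrite (ger0_norm (cutoff_ge0 _ _)) (gtr0_norm rho0) cut_le.
- by have := integrableZl measurableT rho iphi; apply.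
Qed.

(** The limit of [cutoff_evolution] as s tends to tau: the cutoff is continuous
    with compact support, so that it can be used to test the weak convergence
    of zeta to phi. *)
Lemma cutoff_moment_phi rho : 1 <= rho ->
  (\int[lebesgue_rV d]_x (cutoff rho x * phi x)%:E <=
   \int[lebesgue_rV d]_x (cutoff rho x * zeta x r)%:E + c%:E)%E.
Proof.
move=> rho1; have rho0 : 0 < rho by lra.
have h := @adj_initial_weak _ _ _ _ _ _ _ _ zetaP (cutoff rho) (@continuous_cutoff _ _ _).
have /h{}h : exists2 K, compact K & has_support_in (@cutoff R d rho) K.
  exists [set x : 'rV[R]_d | `|x| <= expR rho]; first exact: compact_rV_cball.
  rewrite /has_support_in closureE; apply: smallest_sub.
    exact: compact_closed (@compact_rV_cball _ _ _).
  move=> x /=; apply: contra_neqP => /negP; rewrite -ltNge => xr.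
  by rewrite cutoff_support// ltW.
apply: (cvge_to_le h); near=> s.
have ts : tau < s < r.
  by apply/andP; split; near: s; [exact: nbhs_right_gt|apply: nbhs_right_lt; case/andP: taur].
have := @cutoff_evolution _ _ H T tau u zeta tau0 Hsmooth usmooth (adj_smooth zetaP)
  (adj_ge0 zetaP) (adj_eq zetaP) rho s r M rho1 ts (proj2 (andP taur)) zetaM.
have fz := integrable_fin_num measurableT (icut rho0).
rewrite energyD -EFinM -EFinD.
rewrite (leeBlDr _ _ fz).
by rewrite addeC.
Unshelve. all: by end_near. Qed.

Let integral_cutoffC rho (f : 'rV[R]_d -> R) (a : R) :
  (lebesgue_rV d).-integrable setT (EFin \o f) ->
  (lebesgue_rV d).-integrable setT (EFin \o (fun x => cutoff rho x * f x)) ->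
  (\int[lebesgue_rV d]_x (f x)%:E = M%:E)%E ->
  (\int[lebesgue_rV d]_x (cutoff rho x * f x)%:E = a%:E)%E ->
  (\int[lebesgue_rV d]_x ((rho - cutoff rho x) * f x)%:E = (rho * M - a)%:E)%E.
Proof.
move=> fi cfi fM fa.
under eq_integral do rewrite mulrBl EFinB.
rewrite integralB//=; last by have := integrableZl measurableT rho fi; apply.
rewrite fa; under eq_integral do rewrite EFinM.
by rewrite integralZl// fM -EFinM -EFinB.
Qed.

(** The constant rho has the same integral rho M against zeta (., r) and
    against phi, so that [cutoff_moment_phi] is a bound on rho - cutoff rho.
    This is at least min (weight, rho), and at most 3 W where phi does not
    vanish. *)
Lemma truncated_moment_le rho : 1 <= rho ->
  (\int[lebesgue_rV d]_x (Num.min (weight x) rho * zeta x r)%:E <=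
   (3 * W * M + c)%:E)%E.
Proof.
move=> rho1; have rho0 : 0 < rho by lra.
have fz := fineK (integrable_fin_num measurableT (icut rho0)).
have fp := fineK (integrable_fin_num measurableT (icutphi rho0)).
have Iz := integral_cutoffC izeta (icut rho0) (zetaM taur) (esym fz).
have Ip := integral_cutoffC iphi (icutphi rho0) phiM (esym fp).
have := cutoff_moment_phi rho1; move: Iz Ip; rewrite -fz -fp.
set a := fine _; set b := fine _ => Iz Ip; rewrite -EFinD lee_fin => ba.
have mrho (f : 'rV[R]_d -> R) : measurable_fun setT f ->
    measurable_fun setT (fun x => ((rho - cutoff rho x) * f x)%:E).
  move=> mf; apply/measurable_EFinP/measurable_funM => //.
  by apply: measurable_funB.
have bW : rho * M - b <= 3 * W * M.
  rewrite -lee_fin -Ip EFinM -phiM.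
  rewrite -(integralZl measurableT iphi).
  apply: ge0_le_integral => //.
  - move=> x _; rewrite lee_fin mulr_ge0// subr_ge0; exact: cut_le.
  - exact: mrho.
  - by apply: measurable_funeM; exact/measurable_EFinP.
  - move=> x _; rewrite /= -EFinM lee_fin.
    have [->|px] := eqVneq (phi x) 0; first by rewrite !mulr0.
    rewrite ler_wpM2r//; apply: le_trans (subr_cutoff_le x rho0) _.
    by rewrite ler_wpM2l// phiW.
apply: (@le_trans _ _ (rho * M - a)%:E); last first.
  by rewrite lee_fin; have ba' : b <= a + c := ba; lra.
rewrite -Iz; apply: ge0_le_integral => //.
- by move=> x _; rewrite lee_fin mulr_ge0// le_min weight_ge0 ltW.
- apply/measurable_EFinP/measurable_funM => //.
  apply: measurable_minr => //; apply: continuous_measurable_rV.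
  exact: continuous_weight.
- exact: mrho.
- move=> x _; rewrite lee_fin ler_wpM2r//; exact: subr_cutoff_ge.
Qed.

(** The previous bound does not depend on rho: monotone convergence as rho
    tends to infinity. *)
Lemma moment_le :
  (\int[lebesgue_rV d]_x (weight x * zeta x r)%:E <= (3 * W * M + c)%:E)%E.
Proof.
pose g (n : nat) (x : 'rV[R]_d) := (Num.min (weight x) n%:R * zeta x r)%:E.
have mg n : measurable_fun setT (g n).
  apply/measurable_EFinP/measurable_funM => //.
  apply: measurable_minr => //; apply: continuous_measurable_rV.
  exact: continuous_weight.
have g0 n x : (0 <= g n x)%E.
  by rewrite lee_fin mulr_ge0// le_min weight_ge0 ler0n.
have ndg x : {homo g^~ x : n m / (n <= m)%N >-> (n <= m)%E}.
  move=> n m nm; rewrite lee_fin ler_wpM2r//.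
  by rewrite le_min !ge_min lexx ler_nat nm orbT.
have limg x : limn (g ^~ x) = (weight x * zeta x r)%:E.
  apply: (@lim_near_cst _ _ _ _ _ (weight x * zeta x r)%:E) => //.
  near=> n; congr EFin; congr (_ * _); apply/min_idPl.
  near: n; exact: nbhs_infty_ger.
under eq_integral do rewrite -limg.
rewrite monotone_convergence//.
apply: lime_le.
  apply: ereal_nondecreasing_is_cvgn => n m nm.
  by apply: ge0_le_integral => // x _; exact: ndg.
near=> n; apply: truncated_moment_le.
near: n; exact: nbhs_infty_ger.
Unshelve. all: by end_near. Qed.

End moment.

Theorem lemma4p5 (R : realType) (d : nat)
    (H : 'rV[R]_d -> 'rV[R]_d -> R) (g : R -> R) (uT m0 : 'rV[R]_d -> R)
    (T p' : R) (K : set 'rV[R]_d) :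
  hamiltonian H -> 0 < T -> 1 < p' -> compact K ->
  exists C : R, 0 < C /\
    forall (tau : R) (phi : 'rV[R]_d -> R) (u m zeta : 'rV[R]_d -> R -> R),
      0 <= tau < T ->
      (forall x, 0 <= phi x) ->
      has_support_in phi K ->
      (lebesgue_rV d).-integrable setT (EFin \o phi) ->
      'N[lebesgue_rV d]_(p'%:E)[EFin \o phi]%E = 1%E ->
      mfg_solution H g T uT m0 u m ->
      adjoint_solution H u tau T phi zeta ->
      forall r : R, tau < r <= T ->
        (- C%:E - C%:E * \int[lebesgue_measure]_(t in `]tau, r])
             \int[lebesgue_rV d]_x (enorm (DpH_Du H u x t) ^+ 2 * zeta x t)%:E
         <= \int[lebesgue_rV d]_x (zeta x r * ln (zeta x r))%:E)%E.
Proof.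
move=> hamH T0 p1 cK.
have [B0 [_ KB0]] := compact_bounded cK.
pose B := Num.max (B0 + 1) 0.
have BB0 : B0 < B by rewrite lt_max ltrDl ltr01.
have B_ge0 : 0 <= B by rewrite le_max lexx orbT.
have KB x : K x -> `|x| <= B by move=> Kx; exact: KB0 BB0 _ Kx.
pose V := fine (lebesgue_rV d [set x : 'rV[R]_d | (`|x| <= B)%R]).
have VE : (lebesgue_rV d [set x : 'rV[R]_d | (`|x| <= B)%R] = V%:E)%E.
  by rewrite /V fineK// ge0_fin_numE// lebesgue_rV_cball_lty.
have V0 : 0 <= V by rewrite fine_ge0.
pose W := \sum_(i < d) ln1sqr B.
have W0 : 0 <= W by rewrite sumr_ge0// => i _; exact: ln1sqr_ge0.
have weightW (x : 'rV[R]_d) : `|x| <= B -> weight x <= W.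
  move=> /(rV_norm_leP _ B_ge0) xB; apply: ler_sum => i _.
  rewrite /ln1sqr ler_ln ?posrE ?add1sqr_gt0// lerD2l.
  by rewrite -(real_normK (num_real (x ord0 i))) lerXn2r// nnegrE.
pose E : R := fine (\int[lebesgue_rV d]_x (expR (- weight x))%:E)%E.
have E_ge0 : (0 <= \int[lebesgue_rV d]_x (expR (- weight x))%:E :> \bar R)%E.
  by apply: integral_ge0 => x _; rewrite lee_fin expR_ge0.
have EE : (\int[lebesgue_rV d]_x (expR (- weight x))%:E = E%:E :> \bar R)%E.
  by rewrite /E fineK// ge0_fin_numE// integral_expRN_weight_lty.
have E0 : 0 <= E by rewrite fine_ge0.
pose A := 3 * W + (15 * d)%:R * T.
have A0 : 0 <= A by rewrite addr_ge0 ?mulr_ge0// ltW.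
(* A multiplies the mass, which is at most V + 1, and 3 multiplies the energy;
   E is the integral of exp (- weight). *)
pose C := (V + 1) * A + E + 3.
have VA0 : 0 <= (V + 1) * A by rewrite mulr_ge0// addr_ge0.
have C3 : 3 <= C by rewrite /C; lra.
exists C; split; first lra.
move=> tau phi u m zeta /andP[tau0 tauT] phi0 phiK iphi phi1 solu solz r taur.
rewrite -[X in (_ * X)%E]/(\int[lebesgue_measure]_(t in `]tau, r])
  drift_energy H u zeta t)%E.
set D := (\int[lebesgue_measure]_(t in _) _)%E.
have D0 : (0 <= D)%E.
  apply: integral_ge0 => t /=; rewrite in_itv/= => /andP[h1 h2].
  apply: integral_ge0 => x _; rewrite lee_fin mulr_ge0 ?sqr_ge0//.
  by apply: (adj_ge0 solz); rewrite (ltW h1) (le_trans h2)//; case/andP: taur.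
(* If the energy is infinite, then the lower bound is -oo. *)
have [Doo|] := eqVneq D +oo%E.
  by rewrite Doo gt0_muley ?lte_fin ?addeNy ?leNye//; lra.
rewrite -ltey => Doo; have DE : D = (fine D)%:E by rewrite fineK// ge0_fin_numE.
have phiB x : ~ `|x| <= B -> phi x = 0.
  move=> xB; apply: contra_notP xB => /eqP px; apply: KB; apply: phiK.
  exact: subset_closure.
pose M := fine (\int[lebesgue_rV d]_x (phi x)%:E)%E.
have phiM : (\int[lebesgue_rV d]_x (phi x)%:E = M%:E)%E.
  by rewrite /M fineK//; exact: (integrable_fin_num measurableT iphi).
have M0 : 0 <= M by rewrite fine_ge0// integral_ge0// => x _; rewrite lee_fin.
have MV : M <= V + 1.
  rewrite -lee_fin -phiM EFinD -VE; apply: (integral_le_Lnorm _ _ phi0 _ _ phi1).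
  - exact: measurable_rV_cball.
  - by apply/measurable_EFinP; exact: (measurable_int _ iphi).
  - exact: phiB.
  - exact: ltW.
have usmooth := mfg_smooth_u solu.
have phiW x : phi x != 0 -> weight x <= W.
  by move=> px; apply: weightW; apply: contra_neqP px; exact: phiB.
have mom := moment_le tau0 (ham_smooth hamH) usmooth solz phi0 iphi phiM phiW taur DE.
have z0 x : 0 <= zeta x r.
  by case/andP: taur => h1 h2; apply: (adj_ge0 solz); rewrite (ltW h1).
have mz : measurable_fun setT (zeta ^~ r).
  apply: continuous_measurable_rV.
  exact: C2_continuous (zeta_C2 (adj_smooth solz) taur).
have mwz : measurable_fun setT (fun x => (weight x * zeta x r)%:E).
  apply/measurable_EFinP/measurable_funM => //.
  by apply: continuous_measurable_rV; exact: continuous_weight.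
have mew : measurable_fun setT (fun x : 'rV[R]_d => (expR (- weight x))%:E).
  apply/(@measurable_EFinP _ _ _ _ (fun x => expR (- weight x))).
  by apply: continuous_measurable_rV; exact: continuous_expRN_weight.
have wz0 x : (0 <= (weight x * zeta x r)%:E)%E.
  by rewrite lee_fin mulr_ge0// weight_ge0.
have ew0 (x : 'rV[R]_d) : (0 <= (expR (- weight x))%:E)%E by rewrite lee_fin expR_ge0.
apply: (@le_trans _ _ (- (\int[lebesgue_rV d]_x
    ((weight x * zeta x r)%:E + (expR (- weight x))%:E)))%E); last first.
  apply: oppe_integral_le.
  - apply/measurable_EFinP/measurable_funM => //.
    by apply: (measurableT_comp _ mz); exact: measurable_ln.
  - exact: emeasurable_funD.
  - by move=> x; exact: adde_ge0.
  - by move=> x; rewrite -EFinN -EFinD lee_fin [weight x * _]mulrC entropy_ge.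
rewrite ge0_integralD// EE DE -EFinM -!EFinN -EFinD leeNr.
apply: (le_trans (leeD2r _ mom)).
rewrite -EFinD -EFinN lee_fin opprD !opprK.
have DD : 0 <= fine D by exact: fine_ge0.
have h1 : A * M <= (V + 1) * A by rewrite mulrC ler_wpM2r.
have h2 : 3 * fine D <= C * fine D by rewrite ler_wpM2r.
by rewrite /A in h1; rewrite /C /A in h2 *; lra.
Qed.
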